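(* Let $T\in(0,\infty)$ be fixed. If $\alpha<\frac12$, then $$\mathsf{P}\left(\lim_{t\uparrow T}\frac{X_t^{(\alpha)}}{(T-t)^\alpha}=M_T^{(\alpha)}\right)=1,$$ where $M_T^{(\alpha)}$ is a normally distributed random variable with mean $0$ and with variance $\frac{T^{1-2\alpha}}{1-2\alpha}$ (that is, there exists a random variable $M_T^{(\alpha)}$ with this distribution for which the displayed equality holds). Consequently, $$\mathsf{P}\left(\lim_{t\uparrow T}\frac{X_t^{(\alpha)}}{(T-t)^\beta}=0\right)=1\qquad\text{for all }\beta<\alpha,$$ $$\mathsf{P}\left(\lim_{t\uparrow T}\frac{X_t^{(\alpha)}}{(T-t)^\beta}=-\infty\right)=\mathsf{P}\left(\lim_{t\uparrow T}\frac{X_t^{(\alpha)}}{(T-t)^\beta}=\infty\right)=\frac12\qquad\text{for all }\beta>\alpha.$$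
   Context: Let $(B_t)_{t\geq 0}$ be a one-dimensional standard Wiener process on a probability space $(\Omega,\mathcal{A},\mathsf{P})$ (with a filtration constructed from $B$ satisfying the usual conditions; in particular the space is complete). For $\alpha\in\mathbb{R}$, $(X_t^{(\alpha)})_{t\in[0,T)}$ denotes the unique strong solution (with continuous paths) of the SDE $$\mathrm{d}X_t^{(\alpha)}=-\frac{\alpha}{T-t}X_t^{(\alpha)}\,\mathrm{d}t+\mathrm{d}B_t,\quad t\in[0,T),\qquad X_0^{(\alpha)}=0,$$ namely $X_t^{(\alpha)}=\int_0^t\left(\frac{T-t}{T-s}\right)^\alpha\mathrm{d}B_s$, $t\in[0,T)$. Here $\alpha,\beta$ are real numbers. *)

(* Defs.v *)
From HB Require Import structures.
From mathcomp Require Import all_boot all_order all_algebra.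
From mathcomp Require Import all_classical all_reals all_analysis.
Import Order.TTheory GRing.Theory Num.Theory.
Import numFieldTopology.Exports numFieldNormedType.Exports.

Set Implicit Arguments.
Unset Strict Implicit.
Unset Printing Implicit Defensive.

Local Open Scope classical_set_scope.
Local Open Scope ring_scope.

Section processes.
Context (R : realType) (d : measure_display) (Omega : measurableType d)
  (P : probability Omega R).

(* Measurability of [E] is part of the assertion: a measure of the library is a
   total function, with no meaning on non-measurable sets. *)
Definition has_prob (E : set Omega) (p : R) : Prop :=
  measurable E /\ P E = p%:E.

(* [v] is the variance, whereas [normal_prob] takes the standard deviation;
   only meaningful for [0 < v], because [normal_prob m 0] is a junk value. The
   laws are compared on Borel sets only. *)
Definition normally_distributed (m v : R) (Y : Omega -> R) : Prop :=
  forall A : set R, measurable A ->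
    P (Y @^-1` A) = normal_prob m (Num.sqrt v) A.

(* The product rule for subfamilies is the case where some [A i] are [setT]. *)
Definition mutually_independent (n : nat) (Y : 'I_n -> Omega -> R) : Prop :=
  forall A : 'I_n -> set R, (forall i, measurable (A i)) ->
    P [set w | forall i, A i (Y i w)] = (\prod_(i < n) P (Y i @^-1` A i))%E.

(* Processes are families indexed by all of [R]; a Wiener process is only
   constrained at times [t >= 0], and a process on [0, T) at times of [0, T). *)
Definition standard_wiener_process (B : R -> {RV P >-> R}) : Prop :=
  [/\ {ae P, forall w, B 0 w = 0},
      forall (n : nat) (t : nat -> R), 0 <= t 0%N -> {homo t : i j / (i < j)%N >-> i < j} ->
        mutually_independent (fun (i : 'I_n) w => B (t i.+1) w - B (t i) w),
      forall s t : R, 0 <= s -> s < t ->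
        normally_distributed 0 (t - s) (fun w => B t w - B s w) &
      {ae P, forall w, {within `[0, +oo[%classic, continuous (fun t : R => B t w)}}].

Definition natural_generators (B : R -> {RV P >-> R}) (t : R) :
    set (set Omega) :=
  [set C | exists (s : R) (A : set R), [/\ 0 <= s, s <= t, measurable A & C = B s @^-1` A]].

(* The natural filtration of [B], completed by the [P]-null sets and made
   right-continuous. *)
Definition usual_filtration (B : R -> {RV P >-> R}) (t : R) : set (set Omega) :=
  [set C | forall u, t < u ->
    <<s natural_generators B u `|` P.-negligible >> C].

(* [X] is a strong solution, with continuous paths, on [0, T) of
   dX_t = - alpha / (T - t) X_t dt + dB_t,  X_0 = 0.
   As the diffusion coefficient is 1, the stochastic integral of the integral
   form of the equation is [B t - B 0], which is almost surely [B t]. *)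
Definition strong_solution (alpha T : R) (B X : R -> {RV P >-> R}) : Prop :=
  [/\ forall (t : R) (A : set R), 0 <= t -> t < T -> measurable A ->
        usual_filtration B t (X t @^-1` A),
      {ae P, forall w, X 0 w = 0},
      {ae P, forall w, {within `[0, T[%classic, continuous (fun t : R => X t w)}} &
      {ae P, forall w, forall t : R, 0 <= t -> t < T ->
        X t w = \int[lebesgue_measure]_(s in `[0, t]) (- (alpha / (T - s)) * X s w)
                + B t w}].

End processes.

(* Main.v *)
Require Import Defs.
From HB Require Import structures.
From mathcomp Require Import all_boot all_order all_algebra.
From mathcomp Require Import all_classical all_reals all_analysis.
From mathcomp Require Import measurable_realfun ring lra.
Import Order.TTheory GRing.Theory Num.Theory.
Import numFieldTopology.Exports numFieldNormedType.Exports.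

(** Put [g t = (T - t)^(-alpha)] and [Y t = g t * X t]. The theorem says that
    [Y] has an almost sure limit [M] at [T], of law N(0, int_0^T g^2); the rest
    follows from [X t / (T - t)^beta = Y t * (T - t)^(alpha - beta)], because [M]
    is almost surely nonzero and its sign is symmetric.

    No stochastic integral is needed, since the integrand [g] is smooth. The
    equation and variation of constants show that [F t = g t * (X t - B t)] has
    derivative [- g' t * B t], path by path: this is the integration by parts
    [Y t = g t * B t - int_0^t B dg].

    Convergence is a pathwise fact. Rewrite [Y t = H t + g t * (B t - B T)]
    with [H t = F t + g t * B T], so that [H' t = g' t * (B T - B t)]. As
    [alpha < 1/2] there is a [gam < 1/2] above [alpha] and [0], and Brownian
    motion satisfies [B T - B t = O((T - t)^gam)] almost surely
    ([wiener_holder_point]). Then [H'] is [O((T - t)^(gam - alpha - 1))], hence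
    integrable up to [T], and [g t * (B t - B T)] tends to [0]
    ([sde_path_cvg]). The Hoelder bound at the single time [T] follows from the
    union bound over dyadic increments ([dyadic_chaining], [wiener_sup_tail]),
    a Gaussian tail bound of order four ([normal_prob_tail]) and Borel-Cantelli.

    For the law, fix [t < T]. The same integration by parts shows that [Y t] is
    the limit of the sums of [g s * (B s' - B s)] over finer and finer
    subdivisions of [0, t] ([sde_path_riemann]). These sums are normal, being
    sums of independent normal variables ([normal_sum], by convolution), with
    variances tending to int_0^t g^2. An almost sure limit of centred normal
    variables with converging variances is normal ([normal_ae_limit]): used
    for the mesh tending to [0] it gives the law of [Y t], and used again for
    [t] tending to [T] it gives that of [M]. *)

Set Implicit Arguments.
Unset Strict Implicit.
Unset Printing Implicit Defensive.

Local Open Scope classical_set_scope.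
Local Open Scope ring_scope.

(** * Normal laws on the line *)

Lemma measurable_norm_gt (R : realType) (d : measure_display)
    (T : measurableType d) (f : T -> R) (a : R) :
  measurable_fun setT f -> measurable [set w | a < `|f w|].
Proof.
move=> mf; rewrite (_ : [set _ | _] = (fun w => `|f w|) @^-1` `]a, +oo[%classic).
  rewrite -[X in measurable X]setTI.
  by apply: (measurableT_comp (@normr_measurable R setT) mf).
by apply/seteqP; split=> x /=; rewrite in_itv/= andbT.
Qed.

Section normal_laws.
Context {R : realType}.
Local Notation mu := (@lebesgue_measure R).

Lemma eq_measure_rays (m1 m2 : {measure set (measurableTypeR R) -> \bar R}) :
  (m1 setT < +oo)%E ->
  (forall x : R, m1 `]-oo, x[%classic = m2 `]-oo, x[%classic) ->
  forall A : set R, measurable A -> m1 A = m2 A.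
Proof.
move=> m1oo m12 A mA.
apply: (@measure_unique _ R (measurableTypeR R) (@RGenInftyO.G R)
  (fun n => `]-oo, n%:R[%classic)) => //.
- exact: RGenInftyO.measurableE.
- move=> _ _ [x ->] [y ->]; exists (Num.min x y).
  by apply/seteqP; split=> z /=; rewrite !in_itv/= lt_min => /andP.
- by move=> n; exists n%:R.
- apply/seteqP; split=> // x _; exists (Num.bound `|x : R|) => //=.
  by rewrite in_itv/= (le_lt_trans (ler_norm (x : R)))// archi_boundP.
- by move=> _ [x ->].
- move=> k; apply: le_lt_trans m1oo; apply: le_measure; rewrite ?inE//.
Qed.

Lemma normal_pdf_affine (m s c d x : R) : 0 < c -> s != 0 ->
  normal_pdf m s x = normal_pdf (c * m + d) (c * s) (c * x + d) * c.
Proof.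
move=> c0 s0; have c0' : c != 0 by rewrite gt_eqF.
rewrite !normal_pdfE ?mulf_neq0//.
rewrite /normal_peak /normal_fun [RHS]mulrAC; congr (_ * _).
  rewrite (_ : (c * s) ^+ 2 * pi *+ 2 = c ^+ 2 * (s ^+ 2 * pi *+ 2)); last by ring.
  rewrite (sqrtrM (s ^+ 2 * pi *+ 2) (sqr_ge0 c)) sqrtr_sqr gtr0_norm//.
  by rewrite invfM [RHS]mulrAC mulVf ?mul1r.
congr expR.
by field; rewrite s0 c0'.
Qed.

Lemma normal_prob_ray (m s x : R) : normal_prob m s `]-oo, x[%classic =
  (\int[mu]_(y in `]-oo, x]) (normal_pdf m s y)%:E)%E.
Proof.
rewrite /normal_prob integral_itv_bndo_bndc//.
by apply/measurable_EFinP/measurable_funTS; exact: measurable_normal_pdf.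
Qed.

(** Both sides agree on rays, where this is the change of variables formula. *)
Lemma normal_prob_affine (m s c d : R) (A : set R) : 0 < c -> 0 < s ->
  measurable A ->
  normal_prob m s ((fun x => c * x + d) @^-1` A) =
  normal_prob (c * m + d) (c * s) A.
Proof.
move=> c0 s0 mA.
have s0' : s != 0 by rewrite gt_eqF.
have cs0 : c * s != 0 by rewrite mulf_neq0// gt_eqF.
pose f (x : measurableTypeR R) : measurableTypeR R := c * x + d.
have mf : measurable_fun setT f.
  by apply: measurable_funD => //; apply: measurable_funM.
have df (x : R) : is_derive x (1 : R) (f : R -> R) c.
  rewrite /f; apply: is_derive_eq; rewrite addr0 scaler1//.
have f'E : (f : R -> R)^`()%classic = cst c.
  by apply/funext => x; rewrite derive1E derive_val.
pose ff : {mfun measurableTypeR R >-> measurableTypeR R} :=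
  HB.pack f (isMeasurableFun.Build _ _ _ _ _ mf).
apply: (@eq_measure_rays (pushforward (normal_prob m s) ff)
   (normal_prob (c * m + d) (c * s))); last exact: mA.
  apply: (@le_lt_trans _ _ (normal_prob m s setT)); first exact: lexx.
  by rewrite probability_setT ltry.
move=> y.
pose b := (y - d) / c.
have fb : f b = y by rewrite /f /b mulrC divfK ?subrK// gt_eqF.
transitivity (normal_prob m s `]-oo, b[%classic).
  congr (normal_prob m s _).
  apply/seteqP; split=> x /=; rewrite !in_itv/= -ltrBrDr mulrC -ltr_pdivlMr//.
rewrite normal_prob_ray.
apply: etrans (esym (normal_prob_ray _ _ _)).
rewrite -fb (@increasing_ge0_integration_by_substitutionNy R f)//.
- apply: eq_integral => x _; congr EFin.
  rewrite f'E !fctE; exact: normal_pdf_affine.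
- by move=> u v _ _ uv; rewrite /f ltrD2r ltr_pM2l.
- by move=> x _; rewrite f'E; exact: cvg_cst.
- by rewrite f'E; exact: is_cvg_cst.
- by rewrite f'E; exact: cvg_cst.
- split; first by move=> x _; case: (df x).
  apply: cvg_at_left_filter.
  exact/differentiable_continuous/derivable1_diffP.
- rewrite /f.
  apply: (cvg_comp _ _ (gt0_cvgMrNy c0 cvg_id) (cvg_addrr_Ny d)).
- by apply: continuous_subspaceT; exact: continuous_normal_pdf.
- by move=> x _; exact: normal_pdf_ge0.
Qed.

Lemma expRN_le_sqr (u : R) : 0 < u -> expR (- u) <= 4 / u ^+ 2.
Proof.
move=> u0; rewrite expRN -[leRHS]invrK lef_pV2 ?posrE ?expR_gt0//; last first.
  by rewrite invr_gt0 divr_gt0// exprn_gt0.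
rewrite (_ : (4 / u ^+ 2)^-1 = (u / 2) ^+ 2); last by field; rewrite gt_eqF.
rewrite [in leRHS](_ : u = 2%:R * (u / 2)); last by field.
rewrite expRM_natl ler_sqr ?nnegrE ?expR_ge0 ?divr_ge0 ?(ltW u0)//.
by apply: le_trans (expR_ge1Dx _); lra.
Qed.

(** Half of the exponent pays for the factor: beyond [a], the density of N(0, s^2)
    is that of N(0, 2 s^2) times at most [sqrt 2 * exp (- a^2 / (4 s^2))]. *)
Lemma normal_pdf_tail (s a x : R) : 0 < s -> 0 < a -> a < `|x| ->
  normal_pdf 0 s x <= 128 * (s / a) ^+ 4 * normal_pdf 0 (Num.sqrt 2 * s) x.
Proof.
move=> s0 a0 ax.
have q0 : 0 < Num.sqrt 2 :> R by rewrite sqrtr_gt0.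
have q2 : Num.sqrt 2 <= 2 :> R.
  by rewrite -[leRHS]gtr0_norm// -sqrtr_sqr ler_wsqrtr//; lra.
have x0 : 0 < x ^+ 2 by rewrite -real_normK ?num_real// exprn_gt0// (lt_trans a0).
have xn0 : x != 0 by rewrite -sqrf_eq0 gt_eqF.
rewrite !normal_pdfE ?gt_eqF ?mulr_gt0// /normal_peak /normal_fun !subr0.
have -> : (Num.sqrt 2 * s) ^+ 2 * pi *+ 2 = 2 * (s ^+ 2 * pi *+ 2) :> R.
  by rewrite exprMn sqr_sqrtr//; ring.
rewrite sqrtrM// (exprMn _ (Num.sqrt 2)) sqr_sqrtr// invfM.
set p := (Num.sqrt (s ^+ 2 * pi *+ 2))^-1.
have p0 : 0 <= p by rewrite invr_ge0 sqrtr_ge0.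
rewrite [leRHS](_ : _ = p * (128 * (s / a) ^+ 4 / Num.sqrt 2 *
   expR (- x ^+ 2 / ((2 * s ^+ 2) *+ 2)))); last by ring.
rewrite ler_wpM2l//.
have -> : - x ^+ 2 / (s ^+ 2 *+ 2) =
    - (x ^+ 2 / (4 * s ^+ 2)) + - x ^+ 2 / (2 * s ^+ 2 *+ 2).
  by field; rewrite gt_eqF.
rewrite expRD ler_wpM2r ?expR_ge0//.
apply: (le_trans (expRN_le_sqr _)); first by rewrite divr_gt0// mulr_gt0// exprn_gt0.
rewrite ler_pdivlMr//.
have ax4 : a ^+ 4 <= x ^+ 4.
  rewrite -[x ^+ 4]ger0_norm ?exprn_even_ge0// normrX lerXn2r ?nnegrE ?normr_ge0//.
    exact: ltW.
  exact: ltW.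
rewrite (_ : 4 / _ = 64 * s ^+ 4 / x ^+ 4); last first.
  by field; rewrite xn0 gt_eqF.
rewrite expr_div_n (_ : 128 * _ = 64 * s ^+ 4 / a ^+ 4 * 2); last by ring.
rewrite ler_pM ?(ltW q0)//.
  by rewrite mulr_ge0 ?invr_ge0 ?exprn_even_ge0// mulr_ge0// exprn_ge0// ltW.
rewrite ler_wpM2l ?mulr_ge0 ?exprn_ge0 ?(ltW s0)//.
have a40 : 0 < a ^+ 4 by rewrite exprn_gt0.
by rewrite lef_pV2 ?posrE// (lt_le_trans a40).
Qed.

(** The fourth power matters: it is what makes the union bound over the [2^j]
    increments of length [h / 2^j] summable in [wiener_sup_tail]. *)
Lemma normal_prob_tail (s a : R) : 0 < s -> 0 < a ->
  (normal_prob 0 s [set x : R | (a < `|x|)%R] <= (128 * (s / a) ^+ 4)%:E)%E.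
Proof.
move=> s0 a0.
have mT : measurable [set x : R | a < `|x|].
  exact: (measurable_norm_gt a (@measurable_id _ _ setT)).
pose k := 128 * (s / a) ^+ 4.
have k0 : 0 <= k by rewrite mulr_ge0// exprn_ge0// divr_ge0// ltW.
apply: (@le_trans _ _
  (\int[mu]_(x in [set x : R | (a < `|x|)%R])
     (k%:E * (normal_pdf 0 (Num.sqrt 2 * s) x)%:E))%E).
  apply: ge0_le_integral => //.
  - by move=> x _; rewrite lee_fin normal_pdf_ge0.
  - by apply/measurable_EFinP/measurable_funTS; exact: measurable_normal_pdf.
  - apply/measurable_EFinP/measurable_funTS.
    by apply: measurable_funM => //; exact: measurable_normal_pdf.
  - by move=> x /= ax; rewrite -EFinM lee_fin normal_pdf_tail.
rewrite ge0_integralZl//; first last.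
- by move=> x _; rewrite lee_fin normal_pdf_ge0.
- by apply/measurable_EFinP/measurable_funTS; exact: measurable_normal_pdf.
rewrite -[leRHS]mule1 lee_wpmul2l ?lee_fin//.
exact: (probability_le1 (normal_prob 0 (Num.sqrt 2 * s))).
Qed.

Lemma normal_prob_ge0_half (s : R) : 0 < s ->
  normal_prob 0 s `[0, +oo[%classic = (1 / 2)%:E.
Proof.
move=> s0.
have E : normal_pdf 0 s =1 normal_pdf 0 s \o -%R.
  by move=> x; rewrite /= !normal_pdfE ?gt_eqF// /normal_fun !subr0 sqrrN.
have := @ge0_symfun_integralT R (normal_pdf 0 s) (normal_pdf_ge0 0 s)
  (continuous_normal_pdf (lt0r_neq0 s0)) E.
rewrite integral_normal_pdf -set_itvcy -/(normal_prob 0 s _).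
have : normal_prob 0 s `[0, +oo[%classic \is a fin_num.
  by apply: fin_num_measure.
case: (normal_prob 0 s _) => // r _ [rE]; congr EFin; move: rE; lra.
Qed.

Lemma normal_prob_gt0_half (s : R) : 0 < s ->
  normal_prob 0 s `]0, +oo[%classic = (1 / 2)%:E.
Proof.
move=> s0; rewrite -(normal_prob_ge0_half s0) /normal_prob.
rewrite integral_itv_obnd_cbnd//.
by apply/measurable_EFinP/measurable_funTS; exact: measurable_normal_pdf.
Qed.

Lemma normal_prob_lt0_half (s : R) : 0 < s ->
  normal_prob 0 s `]-oo, 0[%classic = (1 / 2)%:E.
Proof.
move=> s0.
rewrite -setCitvr (probability_setC (normal_prob 0 s))//= normal_prob_ge0_half//.
by rewrite -EFinB; congr EFin; lra.
Qed.

(* makes the simple functions of the approximation coerce to functions *)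
Import HBNNSimple.

Lemma integral_normal_prob (m s : R) (f : R -> \bar R) :
  measurable_fun setT f -> (forall x, 0 <= f x)%E ->
  (\int[normal_prob m s]_x f x = \int[mu]_x (f x * (normal_pdf m s x)%:E))%E.
Proof.
move=> mf' f0.
have mf : measurable_fun [set: measurableTypeR R] f by [].
have mpdf := @measurable_normal_pdf R m s.
have pdf0 := @normal_pdf_ge0 R m s.
pose f_ := nnsfun_approx measurableT mf.
have f_cvg (x : R) : (f_ n x)%:E @[n --> \oo] --> f x.
  exact: (cvg_nnsfun_approx measurableT mf (fun x _ => f0 x)).
have mf_ n : measurable_fun setT (f_ n) by exact: measurable_funP.
have nd_ i j (x : R) : (i <= j)%N -> f_ i x <= f_ j x.
  by move=> ij; have /lefP := nd_nnsfun_approx measurableT mf ij; exact.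
transitivity (limn (fun n => \int[normal_prob m s]_x (f_ n x)%:E)%E).
  rewrite -monotone_convergence//.
  - by apply: eq_integral => x _; apply/esym/cvg_lim => //; exact: f_cvg.
  - by move=> n; apply/measurable_EFinP; exact: mf_.
  - by move=> n x _; rewrite lee_fin.
  - by move=> x _ i j ij; rewrite lee_fin; exact: nd_.
rewrite [X in limn X](_ : _ =
    (fun n => \int[mu]_x ((f_ n x)%:E * (normal_pdf m s x)%:E))%E).
  rewrite -monotone_convergence//.
  - apply: eq_integral => x _; apply/cvg_lim => //.
    apply: cvgeZr => //; exact: f_cvg.
  - move=> n; apply: emeasurable_funM; last exact/measurable_EFinP.
    by apply/measurable_EFinP; exact: mf_.
  - by move=> n x _; rewrite mule_ge0// lee_fin.
  - move=> x _ i j ij; rewrite lee_wpmul2r ?lee_fin//; exact: nd_.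
apply/funext => n; move: (f_ n) => g {f_ f_cvg mf_ nd_}.
rewrite integral_nnsfun// patch_setT sintegralE.
have mg (k : R) : measurable (g @^-1` [set k]) by exact: measurable_sfunP.
transitivity (\sum_(k \in range g)
   \int[mu]_x (k * \1_(g @^-1` [set k]) x * normal_pdf m s x)%:E)%E; last first.
  rewrite -ge0_integral_fsum//.
  - apply: eq_integral => x _; rewrite fsumEFin// -EFinM; congr EFin.
    by rewrite [in RHS](fimfunE g) -mulr_fsuml.
  - move=> k; apply/measurable_EFinP; apply: measurable_funM => //.
    by apply: measurable_funM => //; exact: measurable_indic.
  - move=> k x _; rewrite lee_fin mulr_ge0//.
    have := nnfun_muleindic_ge0 g k x; by rewrite lee_fin.
apply: eq_fsbigr => k /[!inE] -[y _ gy].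
have k0 : 0 <= k by rewrite -gy.
under [RHS]eq_integral do rewrite -mulrA EFinM.
rewrite ge0_integralZl//; first last.
- by move=> x _; rewrite lee_fin mulr_ge0// indicE.
- by apply/measurable_EFinP/measurable_funM => //; exact: measurable_indic.
congr (_ * _)%E.
transitivity (\int[mu]_(x in g @^-1` [set k]) (normal_pdf m s x)%:E)%E => //.
rewrite [LHS]integral_mkcond.
apply: eq_integral => x _; rewrite patchE indicE.
by case: ifPn => _; rewrite ?mul1r ?mul0r.
Qed.

(** Completing the square in [x]: up to the density of the sum at [z], the product
    is the conditional density of the first summand given that the sum is [z]. *)
Lemma normal_pdf_conv (a b x z : R) : 0 < a -> 0 < b ->
  let c := Num.sqrt (a ^+ 2 + b ^+ 2) in
  normal_pdf 0 a x * normal_pdf x b z =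
  normal_pdf 0 c z * normal_pdf (z * a ^+ 2 / c ^+ 2) (a * b / c) x.
Proof.
move=> a0 b0 c.
have ab0 : 0 < a ^+ 2 + b ^+ 2 by rewrite addr_gt0 ?exprn_gt0.
have c0 : 0 < c by rewrite sqrtr_gt0.
have c2 : c ^+ 2 = a ^+ 2 + b ^+ 2 by rewrite sqr_sqrtr// ltW.
rewrite !normal_pdfE ?gt_eqF ?divr_gt0 ?mulr_gt0//.
rewrite mulrACA [RHS]mulrACA -!expRD; congr (_ * expR _).
  rewrite /normal_peak -!invfM -!sqrtrM; try by
    rewrite mulrn_wge0// mulr_ge0 ?pi_ge0 ?sqr_ge0.
  congr (_^-1); congr (Num.sqrt _).
  by rewrite expr_div_n; field; rewrite gt_eqF.
rewrite !expr_div_n !c2; field.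
by rewrite !gt_eqF.
Qed.

(** By Tonelli and [normal_pdf_conv], the inner integral over [x] is that of a
    probability density, so it equals [1]. *)
Lemma normal_prob_conv (a b : R) (A : set R) : 0 < a -> 0 < b -> measurable A ->
  (normal_prob 0 a \x normal_prob 0 b)%E ((fun z => z.1 + z.2) @^-1` A) =
  normal_prob 0 (Num.sqrt (a ^+ 2 + b ^+ 2)) A.
Proof.
move=> a0 b0 mA; set c := Num.sqrt _.
have shift x : normal_prob 0 b (xsection ((fun z => z.1 + z.2) @^-1` A) x) =
    normal_prob x b A.
  rewrite -[in RHS](mul1r b) -[in RHS](add0r x) -[in RHS](mulr0 1).
  rewrite -normal_prob_affine//; congr (normal_prob 0 b _).
  by apply/seteqP; split=> y /=; rewrite /xsection /= mul1r addrC inE.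
rewrite /product_measure1 /=.
under eq_integral do rewrite /= shift.
pose k (z : R * R) := (\1_A z.2 * (normal_pdf 0 a z.1 * normal_pdf z.1 b z.2)).
have mk : measurable_fun setT k.
  apply: measurable_funM.
    by apply: measurableT_comp => //; exact: measurable_indic.
  apply: measurable_funM.
    by apply: measurableT_comp => //; exact: measurable_normal_pdf.
  rewrite (_ : (fun z => _) = (normal_pdf 0 b) \o (fun z : R * R => z.2 - z.1)).
    apply: measurableT_comp; first exact: measurable_normal_pdf.
    exact: measurable_funB.
  by apply/funext => z /=; rewrite !normal_pdfE ?gt_eqF// /normal_fun subr0.
have k0 z : 0 <= k z by rewrite !mulr_ge0 ?normal_pdf_ge0.
have mEk : measurable_fun setT (EFin \o k) by exact/measurable_EFinP.
transitivity (\int[mu]_x \int[mu]_y (EFin \o k) (x, y))%E.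
  have E x : (\int[mu]_y (EFin \o k) (x, y) =
              normal_prob x b A * (normal_pdf 0 a x)%:E)%E.
    rewrite muleC /normal_prob -ge0_integralZl//; first last.
    - by rewrite lee_fin normal_pdf_ge0.
    - by move=> y _; rewrite lee_fin normal_pdf_ge0.
    - by apply/measurable_EFinP/measurable_funTS; exact: measurable_normal_pdf.
    rewrite [RHS]integral_mkcond; apply: eq_integral => y _.
    rewrite patchE /k /= indicE; case: ifPn => _.
      by rewrite mul1r EFinM.
    by rewrite mul0r.
  under [RHS]eq_integral do rewrite E.
  apply: integral_normal_prob => //.
  under eq_fun do rewrite -shift.
  apply: (measurable_fun_xsection (normal_prob 0 b)).
  rewrite -[X in measurable X]setTI; apply: measurable_funD => //.
rewrite fubini_tonelli//= /normal_prob [RHS]integral_mkcond.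
apply: eq_integral => z _; rewrite patchE /k /=.
transitivity (\int[mu]_x ((\1_A z * normal_pdf 0 c z)%:E *
   (normal_pdf (z * a ^+ 2 / c ^+ 2) (a * b / c) x)%:E))%E.
  by apply: eq_integral => x _; rewrite normal_pdf_conv// -EFinM mulrA.
rewrite ge0_integralZl//; first last.
- by rewrite lee_fin mulr_ge0// normal_pdf_ge0.
- by move=> x _; rewrite lee_fin normal_pdf_ge0.
- by apply/measurable_EFinP; exact: measurable_normal_pdf.
rewrite integral_normal_pdf mule1 indicE.
by case: ifPn => _; rewrite ?mul1r ?mul0r.
Qed.

End normal_laws.

(** * Sums and limits of normal random variables *)

Section sums_of_normals.
Context {R : realType} d (Omega : measurableType d) (P : probability Omega R).

(** The event [E] carries the remaining variables along in the induction of
    [normal_sum], so that only products of two laws are ever formed. When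
    [P E > 0], the conditional law of [(U, V)] given [E] is the product of the two
    normal laws, by uniqueness on rectangles. *)
Lemma normal_conv_event (E : set Omega) (U V : Omega -> R) (a b : R) :
  measurable E -> measurable_fun setT U -> measurable_fun setT V ->
  0 < a -> 0 < b ->
  (forall A B : set R, measurable A -> measurable B ->
    P ((U @^-1` A `&` V @^-1` B) `&` E) =
    normal_prob 0 a A * (normal_prob 0 b B * P E))%E ->
  forall A : set R, measurable A ->
    P ((fun w => U w + V w) @^-1` A `&` E) =
    (normal_prob 0 (Num.sqrt (a ^+ 2 + b ^+ 2)) A * P E)%E.
Proof.
move=> mE mU mV a0 b0 UV A mA.
have mUV : measurable_fun setT (fun w => (U w, V w)) by exact/measurable_fun_pair.
have mS : measurable_fun setT (fun w => U w + V w) by exact: measurable_funD.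
have mSA : measurable ((fun w => U w + V w) @^-1` A).
  by rewrite -[X in measurable X]setTI; exact: mS.
have [PE0|PE0] := eqVneq (P E) 0%E.
  rewrite PE0 mule0; apply/eqP; rewrite eq_le measure_ge0 andbT -PE0.
  by apply: le_measure; rewrite ?inE//; exact: measurableI.
pose pE := fine (P E).
have PE : P E = pE%:E by rewrite fineK// fin_num_measure.
have pE0 : 0 < pE by rewrite fine_gt0// lt0e PE0 measure_ge0/= PE ltry.
have q0 : 0 < pE^-1 by rewrite invr_gt0.
pose phi w : measurableTypeR R * measurableTypeR R := (U w, V w).
have mphi : measurable_fun setT phi by [].
have mSS : measurable ((fun z : R * R => z.1 + z.2) @^-1` A).
  by rewrite -[X in measurable X]setTI; apply: measurable_funD.
have H := @product_measure_unique _ _ _ _ R (normal_prob 0 a) (normal_prob 0 b)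
   (mscale (NngNum (ltW q0)) (pushforward (mrestr P mE) phi)).
have {}H := H mphi.
rewrite -(normal_prob_conv a0 b0 mA) (H _ _ mSS).
  rewrite /mscale /= /pushforward /mrestr PE -[LHS]mul1e -(@divff _ pE) ?gt_eqF//.
  by rewrite EFinM -muleA muleC -muleA [(P _ * _)%E]muleC.
move=> B C mB mC.
transitivity ((pE^-1)%:E * P (U @^-1` B `&` V @^-1` C `&` E))%E => //.
rewrite UV// PE [LHS]muleCA; congr (_ * _)%E.
by rewrite muleCA -EFinM mulVf ?gt_eqF// mule1.
Qed.

(** Both probabilities are instances of the product rule, with the sets of the
    indices up to [k] replaced by [setT], except possibly that of [k]. *)
Lemma mutually_independent_after n (Y : 'I_n -> Omega -> R) (k : 'I_n)
    (A : 'I_n -> set R) (B : set R) :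
  mutually_independent P Y -> (forall i, measurable (A i)) -> measurable B ->
  P (Y k @^-1` B `&` [set w | forall i : 'I_n, (k < i)%N -> A i (Y i w)]) =
  (P (Y k @^-1` B) * P [set w | forall i : 'I_n, (k < i)%N -> A i (Y i w)])%E.
Proof.
move=> indY mA mB.
pose D (C : set R) i := if i == k then C else if (k < i)%N then A i else setT.
have mD C i : measurable C -> measurable (D C i).
  by rewrite /D => mC; case: ifP => // _; case: ifP.
have DE C : [set w | forall i, D C i (Y i w)] =
    Y k @^-1` C `&` [set w | forall i : 'I_n, (k < i)%N -> A i (Y i w)].
  apply/seteqP; split=> w /=.
    move=> H; split=> [|i ki]; first by have := H k; rewrite /D eqxx.
    have := H i; rewrite /D ki; case: eqP => // ik.
    by move: ki; rewrite ik ltnn.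
  move=> [Ck H] i; rewrite /D; case: eqP => [->//|_].
  by case: ifP => // /H.
have PD C : measurable C -> P [set w | forall i, D C i (Y i w)] =
    (P (Y k @^-1` C) * \prod_(i < n | i != k) P (Y i @^-1` D setT i))%E.
  move=> mC; rewrite indY; last by move=> i; exact: mD.
  rewrite (bigD1 k)//= {1}/D eqxx; congr (_ * _)%E.
  by apply: eq_bigr => i /negbTE ik; rewrite /D ik.
rewrite -DE PD//; congr (_ * _)%E.
have := PD setT measurableT; rewrite DE preimage_setT setTI => ->.
by rewrite probability_setT mul1e.
Qed.

Lemma normal_sum (n : nat) (Y : nat -> Omega -> R) (v : nat -> R) :
  (forall i, measurable_fun setT (Y i)) -> (forall i, (i <= n)%N -> 0 < v i) ->
  mutually_independent P (fun i : 'I_n.+1 => Y i) ->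
  (forall i, (i <= n)%N -> normally_distributed P 0 (v i) (Y i)) ->
  normally_distributed P 0 (\sum_(i < n.+1) v i)
    (fun w => \sum_(i < n.+1) Y i w).
Proof.
move=> mY v0 indY nY.
have mpre i (B : set R) : measurable B -> measurable (Y i @^-1` B).
  by move=> mB; rewrite -[X in measurable X]setTI; exact: mY.
pose E (k : nat) (A : 'I_n.+1 -> set R) :=
  [set w | forall i : 'I_n.+1, (k < i)%N -> A i (Y i w)].
have mE k A : (forall i, measurable (A i)) -> measurable (E k A).
  move=> mA; rewrite (_ : E k A =
    \bigcap_(i in [set i : 'I_n.+1 | (k < i)%N]) Y i @^-1` A i); last first.
    by apply/seteqP; split.
  by apply: fin_bigcap_measurable => [|i _]; [exact: finite_finset|exact/mpre].
(* the first k+1 variables are summed, the others stay in the event E k A *)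
suff H k : (k <= n)%N -> forall A B, (forall i, measurable (A i)) ->
    measurable B ->
    P ((fun w => \sum_(i < k.+1) Y i w) @^-1` B `&` E k A) =
    (normal_prob 0%R (Num.sqrt (\sum_(i < k.+1) v i)%R) B * P (E k A))%E.
  move=> B mB; have := H n (leqnn _) (fun=> setT) B (fun=> measurableT) mB.
  have -> : E n (fun=> setT) = setT by apply/seteqP; split.
  by rewrite setIT probability_setT mule1.
elim: k => [_ A B mA mB|k IH kn A B mA mB].
  rewrite big_ord1 -(nY 0%N (leq0n _) B mB).
  rewrite (_ : (fun w => _) = Y 0%N); last first.
    by apply/funext => w; rewrite big_ord1.
  exact: (mutually_independent_after ord0 indY mA mB).
pose k1 : 'I_n.+1 := Ordinal (kn : (k.+1 < n.+1)%N).
have vk i : (i < k.+2)%N -> 0 < v i by rewrite ltnS => ik; apply/v0/(leq_trans ik).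
have sv0 : 0 < \sum_(i < k.+1) v i.
  rewrite big_ord_recl ltr_pwDl ?vk// sumr_ge0// => i _; apply/ltW/vk.
  by rewrite lift0 !ltnS ltnW.
rewrite [in RHS]big_ord_recr/=.
rewrite (_ : (fun w => _) = (fun w => \sum_(i < k.+1) Y i w + Y k.+1 w));
  last by apply/funext => w; rewrite big_ord_recr.
rewrite -[X in Num.sqrt (X + _)]sqr_sqrtr ?(ltW sv0)//.
rewrite -[X in Num.sqrt (_ + X)]sqr_sqrtr ?(ltW (vk _ _))//.
apply: normal_conv_event => //; rewrite ?sqrtr_gt0 ?vk//.
- exact: mE.
- by apply: measurable_sum.
move=> C D mC mD.
pose A' i := if i == k1 then D else A i.
have mA' i : measurable (A' i) by rewrite /A'; case: ifP.
have EA' : E k A' = Y k1 @^-1` D `&` E k1 A.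
  apply/seteqP; split=> w /=.
    move=> H; split=> [|i ki].
      by have := H k1 (ltnSn _); rewrite /A' eqxx.
    have := H i (ltnW ki); rewrite /A'; case: eqP => // ik.
    by move: ki; rewrite ik ltnn.
  move=> [Dk H] i ki; rewrite /A'; case: eqP => [->//|/eqP ik].
  apply: H; rewrite ltn_neqAle ki andbT eq_sym.
  by apply: contra ik => /eqP ik; apply/eqP/val_inj.
rewrite -setIA -[X in _ `&` X]EA' IH//; last exact: ltnW.
by rewrite EA' -(nY _ kn D mD); congr (_ * _)%E; exact: (mutually_independent_after k1 indY mA mD).
Qed.

(** Up to a null set [B] lies in the increasing union of the tail intersections,
    each of which is contained in some [F n]. *)
Lemma prob_le_of_eventually (p : \bar R) (B : set Omega) (F : nat -> set Omega) :
  measurable B -> (forall n, measurable (F n)) -> (forall n, P (F n) <= p)%E ->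
  {ae P, forall w, B w -> \forall n \near \oo, F n w} -> (P B <= p)%E.
Proof.
move=> mB mF PF [N [mN PN0 BN]].
pose G n := \bigcap_(k in [set k | (n <= k)%N]) F k.
have mG n : measurable (G n) by exact: bigcap_measurableType.
have PG n : (P (G n) <= p)%E.
  apply: (le_trans _ (PF n)); apply: le_measure; rewrite ?inE//.
  by apply: bigcap_inf => /=.
have mUG : measurable (\bigcup_n G n) by exact: bigcup_measurable.
have BG : B `<=` (\bigcup_n G n) `|` N.
  move=> w Bw; have [Nw|nNw] := pselect (N w); [by right|left].
  have : \forall n \near \oo, F n w.
    by apply: contrapT => H; apply/nNw/BN => /(_ Bw).
  by move=> [m _ mF']; exists m => // k /= mk; exact: mF'.
have cG : P (G n) @[n --> \oo] --> P (\bigcup_n G n).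
  apply: nondecreasing_cvg_mu => // i j ij; apply/subsetPset => w Gw k /= jk.
  by apply: Gw => /=; exact: leq_trans jk.
apply: (@le_trans _ _ (P ((\bigcup_n G n) `|` N))).
  by apply: le_measure; rewrite ?inE//; exact: measurableU.
rewrite measureU0//.
suff : (limn (fun n => P (G n)) <= p)%E by rewrite (cvg_lim _ cG).
apply: lime_le; last exact: nearW.
by apply/cvg_ex; eexists; exact: cG.
Qed.

Lemma normal_scale (Y : Omega -> R) (u c : R) :
  0 < u -> 0 < c ->
  normally_distributed P 0 u Y ->
  normally_distributed P 0 (c ^+ 2 * u) (fun w => c * Y w).
Proof.
move=> u0 c0 nY A mA.
have mA' : measurable ((fun x => c * x + 0) @^-1` A).
  rewrite -[X in measurable X]setTI.
  by apply: measurable_funD => //; apply: measurable_funM.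
have := nY _ mA'; rewrite normal_prob_affine ?sqrtr_gt0// mulr0 addr0.
rewrite sqrtrM ?sqr_ge0// sqrtr_sqr gtr0_norm// => <-; congr (P _).
by apply/seteqP; split=> w /=; rewrite addr0.
Qed.

(** An open set containing the limit contains the sequence eventually, so the law
    of [Z] is at most the normal law on open sets. On the two open rays at [x]
    this bounds the distribution function of [Z] from both sides, up to the
    possible atom at [x], which a limit from the left removes. *)
Lemma normal_ae_limit_same (Y : nat -> Omega -> R) (Z : Omega -> R) (u : R) :
  0 < u -> (forall n, measurable_fun setT (Y n)) -> measurable_fun setT Z ->
  (forall n, normally_distributed P 0 u (Y n)) ->
  {ae P, forall w, Y n w @[n --> \oo] --> Z w} ->
  normally_distributed P 0 u Z.
Proof.
move=> u0 mY mZ nY YZ.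
set N := normal_prob 0 (Num.sqrt u).
have mpre (V : Omega -> R) (B : set R) : measurable_fun setT V -> measurable B ->
    measurable (V @^-1` B).
  by move=> mV mB; rewrite -[X in measurable X]setTI; exact: mV.
have le_open (U : set R) : open U -> (P (Z @^-1` U) <= N U)%E.
  move=> oU; have mU : measurable U by exact: open_measurable.
  apply: (@prob_le_of_eventually _ _ (fun n => Y n @^-1` U)).
  - exact: mpre.
  - by move=> n; exact: mpre.
  - by move=> n; rewrite nY.
  apply: filterS YZ => w Yw Uw.
  by apply: Yw; exact: open_nbhs_nbhs.
have ge_ray x : (N `]-oo, x[%classic <= P (Z @^-1` `]-oo, x]%classic))%E.
  rewrite -(setCK (Z @^-1` _)) probability_setC; last first.
    by apply: measurableC; exact: mpre.
  rewrite preimage_setC setCitvl.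
  apply: (@le_trans _ _ (1 - N `]x, +oo[%classic)%E).
    rewrite -probability_setC// setCitvr; apply: le_measure; rewrite ?inE//.
    by apply: subset_itvl; rewrite bnd_simp.
  by rewrite leeB//; exact/le_open/rray_open.
have mP : (P setT < +oo)%E by rewrite probability_setT ltry.
have Eq x : P (Z @^-1` `]-oo, x[%classic) = N `]-oo, x[%classic.
  apply/eqP; rewrite eq_le; apply/andP; split; first exact/le_open/lray_open.
  pose F (n : nat) := `]-oo, x - n.+1%:R^-1[%classic : set R.
  have UF : \bigcup_n F n = `]-oo, x[%classic.
    apply/seteqP; split=> y /=.
      by move=> [n _]; rewrite /F/= !in_itv/= => /lt_trans; apply; rewrite gtrBl.
    rewrite in_itv/= => /ltr_add_invr[n yn]; exists n => //.
    by rewrite /F/= in_itv/= ltrBrDr.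
  have cF : N (F n) @[n --> \oo] --> N (\bigcup_n F n).
    apply: nondecreasing_cvg_mu => [i||i j ij].
    - exact: measurable_itv.
    - by rewrite UF; exact: measurable_itv.
    apply/subsetPset; apply: subset_itvl.
    by rewrite bnd_simp lerB// lef_pV2 ?posrE// ler_nat.
  have <- : limn (fun n => N (F n)) = N `]-oo, x[%classic.
    by rewrite -UF; exact/cvg_lim.
  apply: lime_le.
    by apply/cvg_ex; eexists; exact: cF.
  apply: nearW => n; apply: (le_trans (ge_ray _)).
  apply: le_measure; rewrite ?inE; [exact: mpre..|].
  apply: preimage_subset; apply: subset_itvl.
  by rewrite bnd_simp gtrBl.
move=> A mA.
pose Z' : Omega -> measurableTypeR R := Z.
have mZ' : measurable_fun setT Z' by [].
have H := @eq_measure_rays _ (pushforward P Z') (normal_prob 0 (Num.sqrt u)).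
exact: (H mZ' mP Eq A mA).
Qed.

(** Dividing by the standard deviations reduces this to a constant law. *)
Lemma normal_ae_limit (Y : nat -> Omega -> R) (Z : Omega -> R)
    (v : nat -> R) (u : R) :
  0 < u -> (forall n, 0 < v n) -> v n @[n --> \oo] --> u ->
  (forall n, measurable_fun setT (Y n)) -> measurable_fun setT Z ->
  (forall n, normally_distributed P 0 (v n) (Y n)) ->
  {ae P, forall w, Y n w @[n --> \oo] --> Z w} ->
  normally_distributed P 0 u Z.
Proof.
move=> u0 v0 vu mY mZ nY YZ.
pose c n := Num.sqrt (u / v n).
have c0 n : 0 < c n by rewrite sqrtr_gt0 divr_gt0.
have c1 : c n @[n --> \oo] --> (1 : R).
  rewrite -sqrtr1 -(divff (lt0r_neq0 u0)).
  apply: (cvg_comp (fun n => u / v n) Num.sqrt); last exact: sqrt_continuous.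
  by apply: cvgM; [exact: cvg_cst|apply: cvgV => //; rewrite gt_eqF].
apply: (@normal_ae_limit_same (fun n w => c n * Y n w)).
- exact: u0.
- by move=> n; apply: measurable_funM.
- exact: mZ.
- move=> n; have := normal_scale (v0 n) (c0 n) (nY n).
  by rewrite sqr_sqrtr ?divfK ?gt_eqF// ltW// divr_gt0.
- apply: filterS YZ => w Yw; rewrite -[Z w]mul1r.
  exact: cvgM.
Qed.

End sums_of_normals.

(** * Real analysis of single paths *)

Section real_analysis.
Context {R : realType}.
Implicit Types (f F h W : R -> R).

Lemma uniform_continuity_itv f (a b e : R) :
  {within `[a, b], continuous f} -> 0 < e ->
  exists2 dl : R, 0 < dl & forall x y, x \in `[a, b] -> y \in `[a, b] ->
    `|x - y| < dl -> `|f x - f y| < e.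
Proof.
move=> /subspace_continuousP cf e0.
have /compact_near_coveringP/near_covering_withinP cK := @segment_compact R a b.
have := cK R (0^'+) (fun dl x => forall y, y \in `[a, b] ->
  `|x - y| < dl -> `|f x - f y| < e) _.
move=> H.
have {H} : \forall dl \near 0^'+, `[a, b] `<=` (fun x => forall y, y \in `[a, b] ->
  `|x - y| < dl -> `|f x - f y| < e).
  apply: H => x abx.
  have := cf x abx => /cvgrPdist_lt/(_ (e / 2)).
  rewrite divr_gt0// => /(_ isT) [/= eta eta0 Heta].
  exists (ball x (eta / 2), [set dl | dl < eta / 2]) => /=.
    split; first by apply: nbhsx_ballx; rewrite divr_gt0.
    by apply: nbhs_right_lt; rewrite divr_gt0.
  move=> [x' dl] /= [xx' dleta] abx' y aby x'y.
  have E1 : `|f x - f x'| < e / 2.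
    apply: Heta => //; rewrite /ball_ /=.
    by apply: (lt_trans xx'); rewrite gtr_pMr//; lra.
  have E2 : `|f x - f y| < e / 2.
    apply: Heta => //; rewrite /ball_ /=.
    rewrite (splitr eta) (le_lt_trans (ler_distD x' _ _))// ltrD//.
    exact: lt_trans x'y _.
  rewrite (splitr e) (le_lt_trans (ler_distD (f x) _ _))// ltrD//.
  by rewrite distrC.
move=> H.
have [dl [/= dl0 Hdl]] : exists dl : R, 0 < dl /\ forall x, x \in `[a, b] ->
   forall y, y \in `[a, b] -> `|x - y| < dl -> `|f x - f y| < e.
  near (0 : R)^'+ => dl; exists dl; split => //.
  by near: dl; apply: filterS H => dl H x abx; exact: H.
by exists dl => // x y abx; exact: Hdl.
Unshelve. all: by end_near. Qed.

(** A dyadic point of level [j.+1] is one of level [j] or its right neighbour at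
    level [j.+1]; so [W] at level [j] is at most the sum of the first allowed
    increments. The bounds [(1/8) (7/8)^j] sum to [1], and [7/8] is close enough
    to [1] for [2 (7/8)^4 > 1], the condition for summing the tails in
    [wiener_sup_tail]. *)
Lemma dyadic_chaining W (h l : R) : 0 < h -> 0 <= l ->
  {within `[0, h], continuous W} -> W 0 = 0 ->
  (forall j k : nat, (k < 2 ^ j)%N ->
    `|W (h * k.+1%:R / 2 ^+ j) - W (h * k%:R / 2 ^+ j)| <= l / 8 * (7 / 8) ^+ j) ->
  forall u, u \in `[0, h] -> `|W u| <= l.
Proof.
move=> h0 l0 cW W0 incr.
have step j : forall k : nat, (k <= 2 ^ j)%N ->
    `|W (h * k%:R / 2 ^+ j)| <= l * (1 - (7 / 8) ^+ j.+1).
  elim: j => [|j IH] k.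
    rewrite expn0 expr0 expr1 divr1; case: k => [_|[|//] _].
      by rewrite mulr0 W0 normr0 mulr_ge0//; lra.
    have := incr 0%N 0%N isT; rewrite expr0 !divr1 mulr0 W0 subr0 mulr1.
    by move/le_trans; apply; lra.
  move=> k2; have r0 : 0 <= (7 / 8 : R) ^+ j.+1 by rewrite exprn_ge0//; lra.
  have half m : h * (m.*2)%:R / 2 ^+ j.+1 = h * m%:R / 2 ^+ j.
    rewrite -muln2 natrM exprS; field.
    by rewrite expf_neq0.
  have := odd_double_half k; case: (odd k) => /= [|]; last first.
    rewrite add0n => kE; rewrite -kE half; apply: le_trans (IH _ _) _.
      by rewrite -leq_double kE (leq_trans k2)// expnS mul2n.
    rewrite ler_wpM2l// lerD2l lerN2 [leLHS]exprS; lra.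
  rewrite add1n => kE.
  have k1 : (k./2 < 2 ^ j)%N.
    by rewrite -ltn_double -mul2n -mul2n -expnS mul2n; rewrite -kE in k2.
  have := incr j.+1 (k./2).*2; rewrite kE half => /(_ k2) D; have {}IH := IH _ (ltnW k1).
  set A := W _ in D *; set B := W _ in D IH.
  rewrite -(subrK B A) (le_trans (ler_normD _ _))//.
  apply: (le_trans (lerD D IH)).
  rewrite [in leRHS]exprS; nra.
move=> u /[dup] uh; rewrite in_itv/= => /andP[u0 uleh].
apply/ler_addgt0Pr => e e0.
have [dl dl0 Hdl] := uniform_continuity_itv cW e0.
have [j hj] : exists j : nat, h / 2 ^+ j < dl.
  exists (Num.bound (h / dl)).
  rewrite ltr_pdivrMr ?exprn_gt0// mulrC -ltr_pdivrMr//.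
  apply: (lt_le_trans (archi_boundP _)); first by rewrite divr_ge0// ltW.
  by rewrite -natrX ler_nat ltnW// ltn_expl.
pose k := Num.truncn (u / h * 2 ^+ j).
have k0 : 0 <= u / h * 2 ^+ j by rewrite mulr_ge0 ?exprn_ge0// divr_ge0// ltW.
have /andP[ku uk] := truncn_itv k0.
have p0 : 0 < (2 : R) ^+ j by rewrite exprn_gt0.
have uE : u = h * (u / h * 2 ^+ j) / 2 ^+ j.
  by field; rewrite !gt_eqF.
have kle : (k <= 2 ^ j)%N.
  rewrite -(ler_nat R) natrX; apply: (le_trans ku).
  by rewrite ler_piMl ?(ltW p0)// ler_pdivrMr// mul1r.
have ku' : h * k%:R / 2 ^+ j <= u.
  by rewrite [leRHS]uE ler_pM2r ?invr_gt0// ler_pM2l.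
have kin : h * k%:R / 2 ^+ j \in `[0, h].
  by rewrite in_itv/= (le_trans ku' uleh) andbT divr_ge0 ?mulr_ge0// ltW.
have kd : `|u - h * k%:R / 2 ^+ j| < dl.
  rewrite ger0_norm ?subr_ge0//; apply: lt_trans hj.
  rewrite {1}uE -mulrBl -mulrBr ltr_pM2r ?invr_gt0//.
  by rewrite gtr_pMr// ltrBlDl natr1; exact: uk.
have := Hdl _ _ uh kin kd => Wd.
rewrite -(subrK (W (h * k%:R / 2 ^+ j)) (W u)) (le_trans (ler_normD _ _))//.
rewrite addrC lerD ?(ltW Wd)//.
apply: (le_trans (step _ _ kle)).
by rewrite ler_piMr// lerBlDr lerDl exprn_ge0//; lra.
Qed.

(** For the [n] with [T / 2^n.+1 < u <= T / 2^n], the bound [2^(- gam n)] is at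
    most [(2 u / T)^gam]. *)
Lemma pow_bound_of_dyadic W (T gam : R) : 0 < T -> 0 < gam ->
  (\forall n \near \oo, forall u, u \in `[0, T / 2 ^+ n] ->
     `|W u| <= (2 `^ (- gam)) ^+ n) ->
  exists C dl : R, 0 < dl /\
    forall u, 0 < u -> u <= dl -> `|W u| <= C * u `^ gam.
Proof.
move=> T0 g0 [N _ HN].
have p0 n : 0 < (2 : R) ^+ n by rewrite exprn_gt0.
exists ((2 / T) `^ gam), (T / 2 ^+ N); split; first by rewrite divr_gt0.
move=> u u0 uN.
have ex : exists n, u > T / 2 ^+ n.
  exists (Num.bound (T / u)).
  rewrite ltr_pdivrMr// mulrC -ltr_pdivrMr//.
  apply: (lt_le_trans (archi_boundP _)); first by rewrite divr_ge0// ltW.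
  by rewrite -natrX ler_nat ltnW// ltn_expl.
have [m um mmin] := ex_minnP ex.
have Nm : (N < m)%N.
  rewrite ltnNge; apply/negP => mN; move: um; apply/negP; rewrite -leNgt.
  apply: (le_trans uN); rewrite ler_pM2l// lef_pV2 ?posrE//.
  by rewrite ler_weXn2l//; lra.
case: m => // m in um mmin Nm *.
have umle : u <= T / 2 ^+ m.
  rewrite leNgt; apply/negP => /mmin; by rewrite ltnn.
apply: (le_trans (HN m Nm u _)); first by rewrite in_itv/= (ltW u0).
rewrite -powRM ?divr_ge0 ?(ltW u0) ?(ltW T0)//.
rewrite -powR_mulrn ?powR_ge0// -powRrM mulrC powRrM powRN.
rewrite -powRN -[- gam]mulN1r powRrM powR_inv1 ?powR_ge0// powR_mulrn//.
rewrite ge0_ler_powR ?nnegrE ?invr_ge0 ?(ltW (p0 _)) ?(ltW g0)//.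
  by rewrite mulr_ge0 ?divr_ge0 ?(ltW T0) ?(ltW u0).
move: um; rewrite exprS => /ltW um.
rewrite mulrAC ler_pdivlMr// mulrC -ler_pdivrMl//.
by apply: le_trans um; rewrite invfM mulrCA mulrA.
Qed.

Lemma abel_summation (g b : nat -> R) n :
  \sum_(i < n) g i * (b i.+1 - b i) =
  g n * b n - g 0%N * b 0%N - \sum_(i < n) b i.+1 * (g i.+1 - g i).
Proof.
elim: n => [|n IH]; first by rewrite !big_ord0 subrr subr0.
by rewrite !big_ord_recr /= IH; ring.
Qed.

(** Stated with a primitive [F] of [f * h'], so that the mean value theorem
    replaces integration: the error on a cell is the increment of
    [F - f (xi) * h], whose derivative [(f x - f (xi)) * h' x] is small by uniform
    continuity of [f]. *)
Lemma riemann_stieltjes_cvg f F h (dh : R -> R) (t K : R) (xi : nat -> nat -> R) :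
  0 < t -> {within `[0, t], continuous f} -> {within `[0, t], continuous F} ->
  {within `[0, t], continuous h} ->
  (forall x, x \in `]0, t[ -> is_derive x 1 h (dh x)) ->
  (forall x, x \in `]0, t[ -> is_derive x 1 F (f x * dh x)) ->
  (forall x, x \in `]0, t[ -> `|dh x| <= K) ->
  (forall n i, (i <= n)%N ->
    t * i%:R / n.+1%:R <= xi n i <= t * i.+1%:R / n.+1%:R) ->
  \sum_(i < n.+1) f (xi n i) *
     (h (t * i.+1%:R / n.+1%:R) - h (t * i%:R / n.+1%:R)) @[n --> \oo]
  --> F t - F 0.
Proof.
move=> t0 cf cF ch dhP dFP dhK xiP.
have K0 : 0 <= K.
  apply: le_trans (dhK (t / 2) _); first exact: normr_ge0.
  by rewrite in_itv/= divr_gt0//= gtr_pMr//; lra.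
apply/cvgrPdist_le => e e0.
have K1 : 0 < (K + 1) * t by rewrite mulr_gt0//; lra.
have [dl dl0 Hdl] := uniform_continuity_itv cf (divr_gt0 e0 K1).
have mesh : \forall n \near \oo, t / n.+1%:R < dl.
  exists (Num.bound (t / dl)) => // m /= tm.
  rewrite ltr_pdivrMr// mulrC -ltr_pdivrMr//.
  apply: (lt_le_trans (archi_boundP _)); first by rewrite divr_ge0// ltW.
  by rewrite ler_nat (leq_trans tm).
near=> n.
pose tau (i : nat) := t * i%:R / n.+1%:R.
have tau0 : tau 0%N = 0 by rewrite /tau mulr0 mul0r.
have tauS i : tau i.+1 - tau i = t / n.+1%:R.
  by rewrite /tau -mulrBl -mulrBr -natr1 addrAC subrr add0r mulr1.
have tn0 : 0 < t / n.+1%:R by rewrite divr_gt0.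
have taun : tau n.+1 = t by rewrite /tau mulfK.
have tau_ge0 i : 0 <= tau i by rewrite divr_ge0// mulr_ge0// ltW.
have tau_le i : (i <= n.+1)%N -> tau i <= t.
  by move=> ile; rewrite -taun ler_pM2r ?invr_gt0// ler_pM2l// ler_nat.
have -> : F t - F 0 = \sum_(i < n.+1) (F (tau i.+1) - F (tau i)).
  rewrite -[in LHS]taun -[in LHS]tau0; elim: n.+1 => [|m IH].
    by rewrite big_ord0 subrr.
  by rewrite big_ord_recr /= -IH; ring.
rewrite -sumrB; apply: (le_trans (ler_norm_sum _ _ _)).
have term (i : 'I_n.+1) : `|F (tau i.+1) - F (tau i) -
    f (xi n i) * (h (tau i.+1) - h (tau i))| <= e / n.+1%:R.
  have ltau : tau i < tau i.+1 by rewrite -subr_gt0 tauS.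
  have sub : `[tau i, tau i.+1] `<=` `[0, t].
    apply: subset_itv; rewrite bnd_simp ?tau_ge0// tau_le//.
  have subo x : x \in `]tau i, tau i.+1[ -> x \in `]0, t[.
    rewrite !in_itv/= => /andP[ax xb]; rewrite (le_lt_trans (tau_ge0 i) ax)/=.
    by rewrite (lt_le_trans xb)// tau_le.
  pose G x := F x - f (xi n i) * h x.
  have dG x : x \in `]tau i, tau i.+1[ ->
      is_derive x 1 G ((f x - f (xi n i)) * dh x).
    move=> /subo xt; have d1 := dhP _ xt; have d2 := dFP _ xt.
    apply: is_derive_eq; rewrite /GRing.scale/=; ring.
  have cG : {within `[tau i, tau i.+1], continuous G}.
    apply: (continuous_subspaceW sub) => x.
    apply: cvgB; first exact: cF.
    by apply: cvgM; [exact: cvg_cst|exact: ch].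
  have [c ci Gc] := MVT ltau dG cG.
  rewrite (_ : F (tau i.+1) - _ - _ = G (tau i.+1) - G (tau i)); last first.
    by rewrite /G; ring.
  rewrite Gc tauS normrM normrM.
  have xiin := xiP n i (ltn_ord i).
  have ct := subo _ ci.
  have fcx : `|f c - f (xi n i)| < e / ((K + 1) * t).
    apply: Hdl.
    - by move: ct; rewrite !in_itv/= => /andP[/ltW -> /ltW ->].
    - rewrite in_itv/=; move: xiin => /andP[ax xb].
      by rewrite (le_trans (tau_ge0 i) ax) (le_trans xb)// tau_le.
    have : t / n.+1%:R < dl by near: n.
    apply: le_lt_trans; rewrite -(tauS i).
    move: xiin ci; rewrite -/(tau i) -/(tau i.+1) in_itv/= => /andP[? ?] /andP[? ?].
    rewrite ler_norml; lra.
  rewrite (gtr0_norm tn0).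
  have := dhK _ ct; have := normr_ge0 (dh c); have := normr_ge0 (f c - f (xi n i)).
  move: fcx; set u := `|_|; set v := `|_| => fcx u0 v0 vK.
  apply: (@le_trans _ _ (e / ((K + 1) * t) * (K + 1) * (t / n.+1%:R))).
    rewrite ler_pM2r// ler_pM//; [exact: ltW|lra].
  rewrite le_eqVlt; apply/orP; left; apply/eqP; field.
  by rewrite gt_eqF// (gt_eqF t0)/=; lra.
apply: (@le_trans _ _ (\sum_(i < n.+1) e / n.+1%:R)).
  by apply: ler_sum => i _; exact: term.
by rewrite sumr_const card_ord -[leLHS]mulr_natr divfK.
Unshelve. all: by end_near. Qed.

Lemma is_derive_powR_sub (T p t : R) : t < T ->
  is_derive t 1 (fun s => (T - s) `^ p) (- p * (T - t) `^ (p - 1)).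
Proof.
move=> tT.
have d1 : is_derive t 1 (fun s : R => T - s) (-1).
  by apply: is_derive_eq; lra.
have Tt : 0 < T - t by rewrite subr_gt0.
have d2 := is_derive1_powR p Tt.
have := @is_derive1_comp R (fun x => x `^ p) (fun s => T - s) t _ _ d2 d1.
by rewrite mulrN1 mulNr.
Qed.

Lemma powRD_gt0 (x r s : R) : 0 < x -> x `^ (r + s) = x `^ r * x `^ s.
Proof. by move=> x0; apply: powRD; rewrite (gt_eqF x0) implybT. Qed.

Lemma cvg_sub_at_left (T : R) : T - t @[t --> T^'-] --> 0^'+.
Proof.
move=> A [e /= e0 H]; exists e => // t /= tT ltT; apply: H; last by rewrite subr_gt0.
by rewrite /ball_/= sub0r normrN.
Qed.

Lemma powR_sub_cvg0 (T p : R) : 0 < p -> (T - t) `^ p @[t --> T^'-] --> (0 : R).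
Proof.
move=> p0; apply: (cvg_comp (fun t : R => T - t) (fun x : R => x `^ p)).
  exact: cvg_sub_at_left.
exact: powR_cvg0.
Qed.

Lemma powR_sub_cvgy (T p : R) : p < 0 -> (T - t) `^ p @[t --> T^'-] --> +oo.
Proof.
move=> p0; apply/gtr0_cvgV0.
  near=> t; rewrite powR_gt0// subr_gt0; near: t.
  by exists 1 => //= t.
rewrite (_ : unstable.inv_fun _ = fun t => (T - t) `^ (- p)).
  by apply: powR_sub_cvg0; rewrite oppr_gt0.
by apply/funext => t; rewrite powRN.
Unshelve. all: by end_near. Qed.

Lemma continuous_powR_sub (T p t : R) : t < T ->
  {for t, continuous (fun s => (T - s) `^ p)}.
Proof.
move=> tT; have d := is_derive_powR_sub p tT.
exact/differentiable_continuous/derivable1_diffP.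
Qed.

(** With [K] a primitive of the bound that vanishes at [T], [F + K] is
    nondecreasing and [- F + K] too; the latter bounds the former, which thus
    converges. *)
Lemma cvg_at_left_of_derive_bound F (dF : R -> R) (T s C p : R) :
  s < T -> 0 < p ->
  (forall t, t \in `]s, T[ -> is_derive t 1 F (dF t)) ->
  (forall t, t \in `]s, T[ -> `|dF t| <= C * (T - t) `^ (p - 1)) ->
  cvg (F t @[t --> T^'-]).
Proof.
move=> sT p0 dFP dFC.
have C0 : 0 <= C.
  have h : (s + T) / 2 \in `]s, T[ by rewrite in_itv/=; lra.
  have := dFC _ h; have := normr_ge0 (dF ((s + T) / 2)) => /le_trans/[apply].
  by rewrite pmulr_lge0// powR_gt0//; lra.
pose K t := - (C / p) * (T - t) `^ p.
have dK t : t \in `]s, T[ -> is_derive t 1 K (C * (T - t) `^ (p - 1)).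
  rewrite in_itv/= => /andP[st tT]; have d := is_derive_powR_sub p tT.
  apply: is_derive_eq; rewrite /GRing.scale/=; field.
  by rewrite gt_eqF.
have K0 t : K t <= 0.
  by rewrite /K mulNr oppr_le0 mulr_ge0 ?powR_ge0// divr_ge0// ltW.
have mono (e : R) : `|e| = 1 ->
    {in `]s, T[ &, {homo (fun t => e * F t + K t) : x y / x <= y}}.
  move=> e1.
  have dG t : t \in `]s, T[ -> is_derive t 1 (fun t => e * F t + K t)
      (e * dF t + C * (T - t) `^ (p - 1)).
    move=> tsT; have d1 := dFP _ tsT; have d2 := dK _ tsT.
    by apply: is_derive_eq; rewrite /GRing.scale/=; ring.
  apply: (@ger0_derive1_le _ _ s T) => [t tsT|t tsT|].
  - by have := dG _ tsT => -[].
  - rewrite derive1E (@derive_val _ _ _ _ _ _ _ (dG _ tsT)).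
    have := dFC _ tsT; rewrite -[X in X <= _]mul1r -e1 -normrM => /ler_normlP[].
    lra.
  - apply: derivable_within_continuous => t tsT; by have := dG _ tsT => -[].
have m1 := mono 1 (normr1 _).
have m2 := mono (-1) (normrN1 _).
pose a := (s + T) / 2.
have asT : a \in `]s, T[ by rewrite in_itv/= /a; lra.
have cK : K t @[t --> T^'-] --> (0 : R).
  rewrite -(mulr0 (- (C / p))); apply: cvgM; first exact: cvg_cst.
  exact: powR_sub_cvg0.
have mT1 : \forall x \near T^'-, s < x by exact: nbhs_left_gt.
have mT2 : \forall x \near T^'-, a < x.
  by apply: nbhs_left_gt; rewrite /a; lra.
have : cvg (1 * F t + K t @[t --> T^'-]).
  apply: nondecreasing_at_left_is_cvgr.
    apply: filterS mT1 => x sx u v; rewrite !in_itv/= => /andP[xu uT] /andP[xv vT].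
    by apply: m1; rewrite in_itv/= ?uT ?vT ?andbT (lt_trans sx).
  apply: filterS mT2 => x ax; exists (F a - K a) => _ [t + <-].
  rewrite /= in_itv/= => /andP[xt tT].
  have tsT : t \in `]s, T[.
    by move: asT; rewrite !in_itv/= => /andP[sa _]; rewrite tT andbT; lra.
  have := m2 _ _ asT tsT (ltW (lt_trans ax xt)); have := K0 t; lra.
move=> /cvg_ex[/= l Fl]; apply/cvg_ex; exists (l - 0).
rewrite (_ : F = fun t => 1 * F t + K t - K t); last by apply/funext => t; ring.
exact: cvgB.
Qed.

End real_analysis.

(** * The equation along a path *)

Section sde_path.
Context {R : realType}.
Local Notation mu := (@lebesgue_measure R).
Variables (T alpha : R) (b x : R -> R).
Hypothesis T0 : 0 < T.
Hypotheses (b0 : b 0 = 0) (x0 : x 0 = 0).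
Hypothesis cb : {within `[0, +oo[%classic, continuous b}.
Hypothesis cx : {within `[0, T[%classic, continuous x}.
Hypothesis sde : forall t : R, 0 <= t -> t < T ->
  x t = \int[lebesgue_measure]_(s in `[0, t]) (- (alpha / (T - s)) * x s) + b t.

Let g t := (T - t) `^ (- alpha).
Let dg t := alpha * (T - t) `^ (- alpha - 1).
(* the drift part x - b of the path; writing it as an integral makes it
   differentiable, which x and b are not *)
Let J t := \int[mu]_(s in `[0, t]) (- (alpha / (T - s)) * x s).
Let F t := g t * J t.

Let dgP t : t < T -> is_derive t 1 g (dg t).
Proof. by move=> tT; have := is_derive_powR_sub (- alpha) tT; rewrite opprK. Qed.

Let J0 : J 0 = 0.
Proof. by have /esym := sde (lexx 0) T0; rewrite x0 b0 addr0. Qed.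

Let gx t : 0 <= t -> t < T -> g t * x t = F t + g t * b t.
Proof. by move=> t0 tT; rewrite {1}sde// mulrDr. Qed.

Let f_cont u : u < T ->
  {within `[0, u], continuous (fun s => - (alpha / (T - s)) * x s)}.
Proof.
move=> uT.
have sub : `[0, u] `<=` `[0, T[ by apply: subset_itvl; rewrite bnd_simp.
have cxu := continuous_subspaceW sub cx.
have cT : {within `[0, u], continuous (fun s => - (alpha / (T - s)))}.
  apply: continuous_in_subspaceT => s; rewrite inE/= in_itv/= => /andP[_ su].
  apply: cvgN; apply: cvgM; first exact: cvg_cst.
  apply: cvgV; first by rewrite subr_eq0 gt_eqF// (le_lt_trans su).
  by apply: cvgB; [exact: cvg_cst|exact: cvg_id].
by move=> s; apply: cvgM; [exact: cT|exact: cxu].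
Qed.

Let f_int u : u < T ->
  mu.-integrable `[0, u] (EFin \o (fun s => - (alpha / (T - s)) * x s)).
Proof.
move=> uT; apply: continuous_compact_integrable; first exact: segment_compact.
exact: f_cont.
Qed.

(* the terms containing the drift cancel: this is variation of constants *)
Let dF t : t \in `]0, T[ -> is_derive t 1 F (b t * - dg t).
Proof.
rewrite in_itv/= => /andP[t0 tT].
pose u := (t + T) / 2.
have tu : t < u by rewrite /u; lra.
have uT : u < T by rewrite /u; lra.
have cf : {for t, continuous (fun s => - (alpha / (T - s)) * x s)}.
  have := f_cont uT; have u0 : 0 < u by exact: lt_trans tu.
  move=> /(continuous_within_itvP _ u0)[+ _ _]; apply.
  by rewrite in_itv/= t0.
have [dJ J'E] := continuous_FTC1_closed tu (f_int uT) t0 cf.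
have d1 : is_derive t 1 J (- (alpha / (T - t)) * x t).
  by apply: DeriveDef; [exact: dJ|rewrite -derive1E; exact: J'E].
have d2 := dgP tT.
rewrite /F; apply: is_derive_eq; rewrite /GRing.scale/=.
have Tt : 0 < T - t by rewrite subr_gt0.
have -> : g t = (T - t) * (T - t) `^ (- alpha - 1).
  rewrite /g -[X in X * _](powRr1 (ltW Tt)) -powRD_gt0//.
  by congr (_ `^ _); ring.
rewrite [x t]sde ?(ltW t0)// -/(J t) /dg; field.
by rewrite gt_eqF.
Qed.

Let cF u : 0 < u -> u < T -> {within `[0, u], continuous F}.
Proof.
move=> u0 uT.
have cg : {within `[0, u], continuous g}.
  apply: continuous_in_subspaceT => s; rewrite inE/= in_itv/= => /andP[_ su].
  by apply: continuous_powR_sub; exact: le_lt_trans uT.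
have cJ := parameterized_integral_continuous (ltW u0) (f_int uT).
by move=> s; apply: cvgM; [exact: cg|exact: cJ].
Qed.

(** Abel summation moves the differences from [b] to [g]; the resulting
    Riemann-Stieltjes sums of [b] against [g] converge to [F t]. *)
Lemma sde_path_riemann t : 0 < t -> t < T ->
  \sum_(i < n.+1) (T - t * i%:R / n.+1%:R) `^ (- alpha) *
     (b (t * i.+1%:R / n.+1%:R) - b (t * i%:R / n.+1%:R)) @[n --> \oo]
  --> (T - t) `^ (- alpha) * x t.
Proof.
change (0 < t -> t < T -> \sum_(i < n.+1) g (t * i%:R / n.+1%:R) *
     (b (t * i.+1%:R / n.+1%:R) - b (t * i%:R / n.+1%:R)) @[n --> \oo]
  --> g t * x t).
move=> t0 tT.
pose tau (n i : nat) := t * i%:R / n.+1%:R.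
have cbt : {within `[0, t], continuous b}.
  by apply: continuous_subspaceW cb; apply: subset_itvl.
have cg : {within `[0, t], continuous g}.
  apply: continuous_in_subspaceT => s; rewrite inE/= in_itv/= => /andP[_ su].
  by apply: continuous_powR_sub; exact: le_lt_trans tT.
have inT s : s \in `]0, t[ -> (s \in `]0, T[) /\ (s < T).
  by rewrite !in_itv/= => /andP[-> /= st]; rewrite (lt_trans st tT).
have := @riemann_stieltjes_cvg R b F (\- g) (fun s => - dg s) t
   (`|alpha| * Num.max (T `^ (- alpha - 1)) ((T - t) `^ (- alpha - 1)))
   (fun n i => tau n i.+1) t0 cbt (cF t0 tT).
move=> /(_ _)/wrap[].
  by move=> s; apply: cvgN; exact: cg.
move=> /(_ _)/wrap[].
  by move=> s /inT[_ sT]; have d := dgP sT; apply: is_derive_eq.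
move=> /(_ _)/wrap[].
  by move=> s /inT[sT _]; exact: dF.
move=> /(_ _)/wrap[].
  move=> s; rewrite in_itv/= => /andP[s0 st].
  rewrite normrN normrM ler_wpM2l// ger0_norm ?powR_ge0// le_max.
  have Tt : 0 < T - t by rewrite subr_gt0.
  have Ts : 0 < T - s by lra.
  have [a0|a0] := leP 0 (- alpha - 1); apply/orP; [left|right].
    by rewrite ge0_ler_powR ?nnegrE//; lra.
  rewrite -[- alpha - 1]opprK !(powRN _ (- (- alpha - 1))) lef_pV2 ?posrE ?powR_gt0//.
  by rewrite ge0_ler_powR ?nnegrE//; lra.
move=> /(_ _)/wrap[].
  move=> n i _; rewrite lexx andbT ler_pM2r ?invr_gt0// ler_pM2l//.
  by rewrite ler_nat.
rewrite [in F 0]/F J0 mulr0 subr0 => cvF.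
rewrite gx ?(ltW t0)//; apply: cvg_trans (cvgD cvF (cvg_cst (g t * b t))).
apply: near_eq_cvg; apply: nearW => n.
rewrite fctE (abel_summation (g \o tau n) (b \o tau n)) /=.
have -> : tau n n.+1 = t by rewrite /tau mulfK.
have -> : tau n 0%N = 0 by rewrite /tau mulr0 mul0r.
rewrite b0 mulr0 subr0 addrC; congr (_ + _).
rewrite -sumrN; apply: eq_bigr => i _; rewrite /tau; ring.
Qed.

(** [g * x] is the sum of [H = F + g * b T], whose derivative [dg * (b T - b)] is
    [O((T - t)^(gam - alpha - 1))], and of [g * (b - b T)], which is
    [O((T - t)^(gam - alpha))]. *)
Lemma sde_path_cvg (C dl gam : R) : 0 < dl -> alpha < gam -> 0 < gam ->
  (forall u, 0 < u -> u <= dl -> `|b T - b (T - u)| <= C * u `^ gam) ->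
  cvg ((T - t) `^ (- alpha) * x t @[t --> T^'-]).
Proof.
move=> dl0 ag g0 hC; change (cvg (g t * x t @[t --> T^'-])).
pose H t := F t + g t * b T.
pose s := Num.max 0 (T - dl).
have s0 : 0 <= s by rewrite le_max lexx.
have sdl : T - dl <= s by rewrite le_max lexx orbT.
have sT : s < T by rewrite gt_max T0/=; lra.
have C0 : 0 <= C.
  have := hC _ dl0 (lexx _); have := normr_ge0 (b T - b (T - dl)).
  by move=> /le_trans/[apply]; rewrite pmulr_lge0// powR_gt0.
have cH : cvg (H t @[t --> T^'-]).
  apply: (@cvg_at_left_of_derive_bound R H
    (fun t => dg t * (b T - b t)) T s (`|alpha| * C) (gam - alpha)) => //.
  - by rewrite subr_gt0.
  - move=> t tsT.
    have tT : t \in `]0, T[.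
      by move: tsT; rewrite !in_itv/= => /andP[st ->]; rewrite (le_lt_trans s0).
    have d1 := dF tT.
    have d2 : is_derive t 1 g (dg t).
      by apply: dgP; move: tT; rewrite in_itv/= => /andP[].
    rewrite /H; apply: is_derive_eq; rewrite /GRing.scale/=; ring.
  - move=> t; rewrite in_itv/= => /andP[st tT].
    have Tt : 0 < T - t by rewrite subr_gt0.
    have := hC _ Tt; rewrite subKr => /(_ _)/wrap[]; first lra.
    move=> bC; rewrite /dg normrM normrM -!mulrA ler_wpM2l//.
    rewrite ger0_norm ?powR_ge0//.
    apply: (le_trans (ler_wpM2l (powR_ge0 _ _) bC)).
    rewrite mulrCA ler_wpM2l// -powRD_gt0//.
    by rewrite (_ : - alpha - 1 + gam = gam - alpha - 1)//; ring.
have c0 : g t * (b t - b T) @[t --> T^'-] --> (0 : R).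
  apply: norm_cvg0.
  apply: (@squeeze_cvgr _ _ _ _ (fun=> 0) (fun t => C * (T - t) `^ (gam - alpha))).
  - near=> t; rewrite normr_ge0/= normrM ger0_norm ?powR_ge0//.
    have tT : t < T by near: t; exact: nbhs_left_lt.
    have st : s < t by near: t; exact: nbhs_left_gt.
    have Tt : 0 < T - t by rewrite subr_gt0.
    have := hC _ Tt; rewrite subKr distrC => /(_ _)/wrap[]; first lra.
    move=> bC; apply: (le_trans (ler_wpM2l (powR_ge0 _ _) bC)).
    rewrite mulrCA ler_wpM2l// -powRD_gt0//.
    by rewrite [- alpha + gam]addrC.
  - exact: cvg_cst.
  - rewrite -(mulr0 C); apply: cvgM; first exact: cvg_cst.
    by apply: powR_sub_cvg0; rewrite subr_gt0.
move/cvg_ex : cH => [/= l Hl]; apply/cvg_ex; exists (l + 0).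
apply: cvg_trans (cvgD Hl c0); apply: near_eq_cvg; near=> t.
rewrite gx.
- by transitivity (H t + g t * (b t - b T)); rewrite // /H; ring.
- by apply: ltW; near: t; exact: nbhs_left_gt.
- by near: t; exact: nbhs_left_lt.
Unshelve. all: by end_near. Qed.

End sde_path.

(** * Hoelder continuity of Brownian motion at a fixed time *)

Lemma nneseries_le_geometric (R : realType) (u : nat -> \bar R) (a q : R) :
  0 <= a -> 0 <= q < 1 -> (forall n, 0 <= u n)%E ->
  (forall n, u n <= (a * q ^+ n)%:E)%E ->
  (\sum_(n <oo) u n <= (a / (1 - q))%:E)%E.
Proof.
move=> a0 /andP[q0 q1] u0 uq.
have q10 : 0 < 1 - q by rewrite subr_gt0.
apply: lime_le; first exact: is_cvg_nneseries.
apply: nearW => n.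
apply: (@le_trans _ _ (\sum_(0 <= i < n) (a * q ^+ i)%:E)%E).
  by apply: lee_sum => i _.
rewrite sumEFin lee_fin big_mkord -mulr_sumr ler_wpM2l//.
have geo m : (1 - q) * \sum_(i < m) q ^+ i = 1 - q ^+ m.
  elim: m => [|m IH]; first by rewrite big_ord0 mulr0 subrr.
  by rewrite big_ord_recr /= mulrDr IH exprS; ring.
by rewrite -div1r ler_pdivlMr// mulrC geo gerBl exprn_ge0.
Qed.

Lemma within_continuous_reflect (R : realType) (b : R -> R) (T h : R) :
  h <= T ->
  {within `[0, +oo[%classic, continuous b} ->
  {within `[0, h], continuous (fun u => b T - b (T - u))}.
Proof.
move=> hT /subspace_continuousP cb; apply/subspace_continuousP => u /=.
rewrite in_itv/= => /andP[u0 uh]; apply: cvgB; first exact: cvg_cst.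
have Tu : `[0, +oo[%classic (T - u) by rewrite /= in_itv/= andbT subr_ge0 (le_trans uh).
apply: (cvg_comp (fun u => T - u) b); last exact: cb Tu.
have cT : T - v @[v --> u] --> T - u.
  by apply: cvgB; [exact: cvg_cst|exact: cvg_id].
move=> A wA.
have H : nbhs u (fun v => `[0, +oo[%classic (T - v) -> A (T - v)) := cT _ wA.
change (nbhs u (fun v => `[0, h]%classic v -> A (T - v))).
apply: filterS H => v vA.
rewrite /= in_itv/= => /andP[v0 vh]; apply: vA.
by rewrite /= in_itv/= andbT subr_ge0 (le_trans vh).
Qed.

Section wiener.
Context (R : realType) (d : measure_display) (Omega : measurableType d).
Context (P : probability Omega R) (B : R -> {RV P >-> R}).
Hypothesis hB : standard_wiener_process B.

Lemma measurable_increment s t : measurable_fun setT (fun w => B t w - B s w).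
Proof. by apply: measurable_funB. Qed.

Lemma wiener_increment_tail (s t a : R) : 0 <= s -> s < t -> 0 < a ->
  (P [set w | (a < `|B t w - B s w|)%R] <= (128 * (t - s) ^+ 2 / a ^+ 4)%:E)%E.
Proof.
move=> s0 st a0; have [_ _ hN _] := hB.
have v0 : 0 < t - s by rewrite subr_gt0.
have mA : measurable [set x : R | a < `|x|].
  exact: (measurable_norm_gt a (@measurable_id _ _ setT)).
have := hN s t s0 st _ mA => ->.
apply: (le_trans (normal_prob_tail _ a0)); first by rewrite sqrtr_gt0.
rewrite lee_fin expr_div_n -mulrA.
by rewrite (exprM (Num.sqrt _) 2 2) sqr_sqrtr ?(ltW v0).
Qed.

(** The exceptional event says that some dyadic increment on [T - h, T] exceeds
    its allowance [l / 8 * (7 / 8)^j]. Level [j] has [2^j] increments, each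
    exceeding it with probability [O((h / 2^j)^2 / (l (7 / 8)^j)^4)], so level [j]
    contributes [O(h^2 / l^4 * q^j)] with [q = 1 / (2 (7 / 8)^4) < 1]. *)
Lemma wiener_sup_tail : exists2 K : R, 0 <= K &
  forall T h l, 0 < h -> h <= T -> 0 < l ->
  exists E : set Omega, [/\ measurable E, (P E <= (K * h ^+ 2 / l ^+ 4)%:E)%E &
    forall w, ~ E w ->
      {within `[0, +oo[%classic, continuous (fun t : R => B t w)} ->
      forall u, u \in `[0, h] -> `|B T w - B (T - u) w| <= l].
Proof.
have [q [q0 q1 qE]] : exists q : R, [/\ 0 < q, q < 1 & q = ((7 / 8) ^+ 4 * 2)^-1].
  have H : 1 < (7 / 8) ^+ 4 * 2 :> R by rewrite !exprS expr0; lra.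
  exists ((7 / 8) ^+ 4 * 2)^-1; split => //.
  by rewrite invf_lt1// (lt_trans _ H).
have [K0 [K00 K0E]] : exists K0 : R, 0 <= K0 /\ K0 = 128 * 8 ^+ 4.
  by exists (128 * 8 ^+ 4).
have q10 : 0 < 1 - q by rewrite subr_gt0.
exists (K0 / (1 - q)); first by rewrite divr_ge0// ltW.
move=> T h l h0 hT l0.
pose D (j k : nat) := [set w | l / 8 * (7 / 8) ^+ j <
  `|B (T - h * k%:R / 2 ^+ j) w - B (T - h * k.+1%:R / 2 ^+ j) w|].
have mD j k : measurable (D j k).
  by apply: measurable_norm_gt; exact: measurable_increment.
pose E j := \big[setU/set0]_(k < 2 ^ j) D j k.
have mE j : measurable (E j) by exact: bigsetU_measurable.
exists (\bigcup_j E j); split.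
- exact: bigcupT_measurable.
- apply: (le_trans (generalized_Boole_inequality _ _ _)) => //.
    exact: bigcupT_measurable.
  rewrite (_ : K0 / (1 - q) * h ^+ 2 / l ^+ 4 =
    (K0 * h ^+ 2 / l ^+ 4) / (1 - q)); last by field; rewrite !gt_eqF.
  apply: nneseries_le_geometric.
  + by rewrite divr_ge0 ?mulr_ge0 ?exprn_ge0 ?(ltW h0) ?(ltW l0).
  + by rewrite (ltW q0).
  + by move=> j; exact: measure_ge0.
  move=> j; apply: (le_trans (Boole_inequality _ _)) => //.
  have p0 : 0 < (2 : R) ^+ j by rewrite exprn_gt0.
  have r0 : 0 < (7 / 8 : R) ^+ j by rewrite exprn_gt0//; lra.
  apply: (@le_trans _ _ (\sum_(k < 2 ^ j)
     (128 * (h / 2 ^+ j) ^+ 2 / (l / 8 * (7 / 8) ^+ j) ^+ 4)%:E)%E).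
    apply: lee_sum => k _.
    have st : T - h * k.+1%:R / 2 ^+ j < T - h * k%:R / 2 ^+ j.
      by rewrite ltrD2l ltrN2 ltr_pM2r ?invr_gt0// ltr_pM2l// ltr_nat.
    have s0 : 0 <= T - h * k.+1%:R / 2 ^+ j.
      rewrite subr_ge0 (le_trans _ hT)// -mulrA ler_piMr ?(ltW h0)//.
      by rewrite ler_pdivrMr// mul1r -natrX ler_nat.
    have := wiener_increment_tail s0 st (_ : 0 < l / 8 * (7 / 8) ^+ j).
    move=> /(_ _)/wrap[]; first by rewrite mulr_gt0// divr_gt0.
    move/le_trans; apply; rewrite lee_fin le_eqVlt; apply/orP; left; apply/eqP.
    congr (_ * _ ^+ 2 / _); rewrite -natr1; field.
    by rewrite gt_eqF.
  rewrite sumEFin lee_fin sumr_const card_ord -[leLHS]mulr_natr natrX.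
  rewrite le_eqVlt; apply/orP; left; apply/eqP.
  have -> : q ^+ j = ((7 / 8) ^+ j ^+ 4 * 2 ^+ j)^-1.
    by rewrite qE -exprM mulnC exprM -exprMn exprVn.
  rewrite K0E !exprMn exprVn; field.
  by rewrite !gt_eqF.
move=> w nE cB; apply: dyadic_chaining => //.
- exact: ltW.
- exact: (within_continuous_reflect hT cB).
- by rewrite subr0 subrr.
move=> j k kj.
rewrite (_ : _ - _ - _ = B (T - h * k%:R / 2 ^+ j) w -
   B (T - h * k.+1%:R / 2 ^+ j) w); last by ring.
rewrite leNgt; apply/negP => H; apply: nE; exists j => //.
by rewrite /E -bigcup_mkord; exists k.
Qed.

(** Borel-Cantelli for [h = T / 2^n] and [l = 2^(- gam n)]: the exceptional
    probabilities are [O((4 * 2^(- 4 gam))^(- n))], summable as [gam < 1 / 2]. *)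
Lemma wiener_holder_point (T gam : R) : 0 < T -> 0 < gam -> gam < 1 / 2 ->
  {ae P, forall w, exists C dl : R, 0 < dl /\
    forall u, 0 < u -> u <= dl -> `|B T w - B (T - u) w| <= C * u `^ gam}.
Proof.
move=> T0 g0 g12; have [K K0 HK] := wiener_sup_tail.
pose r : R := 2 `^ (- gam).
have r0 : 0 < r by rewrite powR_gt0.
have p0 n : 0 < (2 : R) ^+ n by rewrite exprn_gt0.
have h0 n : 0 < T / 2 ^+ n by rewrite divr_gt0.
have hT n : T / 2 ^+ n <= T.
  by rewrite ler_pdivrMr// ler_peMr ?(ltW T0)// exprn_ege1//; lra.
have rn0 n : 0 < r ^+ n by rewrite exprn_gt0.
have [E HE] := choice (fun n => HK T (T / 2 ^+ n) (r ^+ n) (h0 n) (hT n) (rn0 n)).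
have r4 : 1 < 4 * r ^+ 4.
  rewrite /r -powR_mulrn ?powR_ge0// -powRrM.
  rewrite (_ : 4 * _ = 2 `^ 2 * 2 `^ (- gam * 4)); last first.
    by rewrite powR_mulrn// -natrX.
  rewrite -powRD_gt0//.
  have c0 : 0 < 2 + - gam * 4 by lra.
  have /= := @gt0_ltr_powR _ _ c0 1 2.
  by rewrite powR1; apply; rewrite ?nnegrE; lra.
have PE0 : P (lim_sup_set E) = 0.
  apply: lim_sup_set_cvg0; first by move=> n; have [] := HE n.
  apply: (@le_lt_trans _ _ (K * T ^+ 2 / (1 - (4 * r ^+ 4)^-1))%:E); last exact: ltry.
  apply: nneseries_le_geometric.
  - by rewrite mulr_ge0// exprn_ge0// ltW.
  - by rewrite invr_ge0 ltW ?mulr_gt0 ?exprn_gt0//= invf_lt1// (lt_trans _ r4).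
  - by move=> n; exact: measure_ge0.
  move=> n; have [_ + _] := HE n; move/le_trans; apply.
  rewrite lee_fin le_eqVlt; apply/orP; left; apply/eqP.
  have four : 2 ^+ 2 = 4 :> R by ring.
  have -> : (4 * r ^+ 4)^-1 ^+ n = ((2 ^+ n) ^+ 2 * (r ^+ n) ^+ 4)^-1.
    by rewrite -!exprM ![(n * _)%N]mulnC !exprM -exprMn exprVn four.
  by field; rewrite !gt_eqF.
have [_ _ _ cB] := hB.
have aeE : {ae P, forall w, ~ lim_sup_set E w}.
  exists (lim_sup_set E); split => //.
    apply: bigcap_measurable => // n _; apply: bigcup_measurable => k _.
    by have [] := HE k.
  by move=> w /=; exact: contrapT.
near=> w.
have cw : {within `[0, +oo[%classic, continuous (fun t : R => B t w)} by near: w.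
have nE : ~ lim_sup_set E w by near: w.
apply: (@pow_bound_of_dyadic R (fun u => B T w - B (T - u) w) T gam T0 g0).
have [n nEn] : exists n, forall k, (n <= k)%N -> ~ E k w.
  apply: contrapT => H; apply: nE => n _.
  apply: contrapT => H'; apply: H; exists n => k nk Ekw; apply: H'.
  by exists k.
exists n => // k /= nk u uk.
by have [_ _] := HE k; apply => //; exact: nEn.
Unshelve. all: by end_near. Qed.

End wiener.

(** * The normalized solution and its limit *)

Section almost_sure.
Context (R : realType) (d : measure_display) (Omega : measurableType d).
Context (P : probability Omega R).

Lemma has_prob_of_ae (E A : set Omega) (p : R) : measure_is_complete P ->
  measurable A -> P A = p%:E -> {ae P, forall w, E w <-> A w} -> has_prob P E p.
Proof.
move=> hP mA PA [N [mN N0 EAN]].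
have EA w : ~ N w -> (E w <-> A w).
  by move=> nN; apply: contrapT => H; apply/nN/EAN.
have mEN : measurable (E `&` N) by apply: hP; exists N; split=> // w [].
have mE : measurable E.
  rewrite (_ : E = (A `\` N) `|` (E `&` N)).
    by apply: measurableU => //; exact: measurableD.
  apply/seteqP; split=> w /=.
    by move=> Ew; have [Nw|nN] := pselect (N w); [right|left; split=> //; apply/EA].
  by move=> [[Aw nN]|[]//]; apply/EA.
split=> //; rewrite -PA -(measureU0 mE mN N0) -(measureU0 mA mN N0).
congr (P _); apply/seteqP; split=> w /= [Ew|]; try by right.
- by have [Nw|nN] := pselect (N w); [right|left; apply/EA].
- by have [Nw|nN] := pselect (N w); [right|left; apply/EA].
Qed.

Lemma mutually_independent_scale n (Y : 'I_n -> Omega -> R) (c : 'I_n -> R) :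
  mutually_independent P Y -> mutually_independent P (fun i w => c i * Y i w).
Proof.
move=> indY A mA; apply: (indY (fun i => ( *%R (c i)) @^-1` A i)) => i.
by rewrite -[X in measurable X]setTI; apply: measurable_funM.
Qed.

End almost_sure.

Section bridge.
Context (R : realType) (d : measure_display) (Omega : measurableType d).
Context (P : probability Omega R) (T alpha : R) (B X : R -> {RV P >-> R}).
Hypothesis hP : measure_is_complete P.
Hypothesis T0 : 0 < T.
Hypothesis alpha_lt : alpha < 1 / 2.
Hypothesis hB : standard_wiener_process B.
Hypothesis hX : strong_solution alpha T B X.

Let g t := (T - t) `^ (- alpha).
Let Y t w := g t * X t w.
(* V t = int_0^t g^2 *)
Let V t := (T `^ (1 - 2 * alpha) - (T - t) `^ (1 - 2 * alpha)) / (1 - 2 * alpha).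

Let a0 : 0 < 1 - 2 * alpha. Proof. by move: alpha_lt; lra. Qed.

Let mY t : measurable_fun setT (Y t).
Proof. by apply: measurable_funM. Qed.

Let V_gt0 t : 0 < t -> t < T -> 0 < V t.
Proof.
move=> t0 tT; rewrite divr_gt0// subr_gt0 gt0_ltr_powR ?nnegrE//; lra.
Qed.

Let wiener_sum n (t : R) w := \sum_(i < n.+1) g (t * i%:R / n.+1%:R) *
     (B (t * i.+1%:R / n.+1%:R) w - B (t * i%:R / n.+1%:R) w).

Let sum_var n (t : R) := \sum_(i < n.+1) g (t * i%:R / n.+1%:R) ^+ 2 *
     (t * i.+1%:R / n.+1%:R - t * i%:R / n.+1%:R).

Let tau_lt (t : R) n i j : 0 < t -> (i < j)%N ->
  t * i%:R / n.+1%:R < t * j%:R / n.+1%:R.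
Proof. by move=> t0 ij; rewrite ltr_pM2r ?invr_gt0// ltr_pM2l// ltr_nat. Qed.

Let tau_le (t : R) n i : 0 < t -> (i <= n.+1)%N -> t * i%:R / n.+1%:R <= t.
Proof.
by move=> t0 iln; rewrite ler_pdivrMr// ler_pM2l// ler_nat.
Qed.

Let term_gt0 t n i : 0 < t -> t < T -> (i <= n)%N ->
  0 < g (t * i%:R / n.+1%:R) ^+ 2 *
      (t * i.+1%:R / n.+1%:R - t * i%:R / n.+1%:R).
Proof.
move=> t0 tT iln; rewrite mulr_gt0 ?subr_gt0 ?tau_lt// exprn_gt0// powR_gt0//.
by rewrite subr_gt0 (le_lt_trans _ tT)// tau_le// (leq_trans iln).
Qed.

Let wiener_sum_normal n t : 0 < t -> t < T ->
  normally_distributed P 0 (sum_var n t) (wiener_sum n t).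
Proof.
move=> t0 tT; have [_ hI hN _] := hB.
pose tau i := t * i%:R / n.+1%:R.
have tau0 : tau 0%N = 0 by rewrite /tau mulr0 mul0r.
have tau_ge0 i : 0 <= tau i by rewrite divr_ge0// mulr_ge0// ltW.
apply: (@normal_sum _ _ _ P n (fun i w => g (tau i) * (B (tau i.+1) w - B (tau i) w))
  (fun i => g (tau i) ^+ 2 * (tau i.+1 - tau i))).
- by move=> i; apply: measurable_funM => //; exact: measurable_increment.
- by move=> i iln; exact: term_gt0.
- apply: (mutually_independent_scale (fun i : 'I_n.+1 => g (tau i))).
  apply: (hI n.+1 tau); first by rewrite tau0.
  by move=> i j ij; exact: tau_lt.
- move=> i iln; apply: normal_scale.
  + by rewrite subr_gt0 tau_lt.
  + rewrite powR_gt0// subr_gt0 (le_lt_trans _ tT)// tau_le// (leq_trans iln)//.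
  + by apply: hN; [exact: tau_ge0|exact: tau_lt].
Qed.

Let sum_var_cvg t : 0 < t -> t < T -> sum_var n t @[n --> \oo] --> V t.
Proof.
move=> t0 tT.
pose F s := - (T - s) `^ (1 - 2 * alpha) / (1 - 2 * alpha).
have sT s : s \in `[0, t] -> s < T.
  by rewrite in_itv/= => /andP[_ st]; exact: le_lt_trans tT.
have dF s : s < T -> is_derive s 1 F (g s ^+ 2 * 1).
  move=> sltT; have d1 := is_derive_powR_sub (1 - 2 * alpha) sltT.
  rewrite /F; apply: is_derive_eq; rewrite /GRing.scale/=.
  have -> : g s ^+ 2 = (T - s) `^ (1 - 2 * alpha - 1).
    rewrite -powR_mulrn ?powR_ge0// -powRrM; congr (_ `^ _); ring.
  by field; rewrite gt_eqF.
have -> : V t = F t - F 0 by rewrite /V /F subr0; field; rewrite gt_eqF.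
apply: (@riemann_stieltjes_cvg R (fun s => g s ^+ 2) F id (fun=> 1) t 1
  (fun n i => t * i%:R / n.+1%:R)) => //.
- apply: continuous_in_subspaceT => s /set_mem/sT sltT.
  by apply: (cvg_comp g (fun x => x ^+ 2));
    [exact: continuous_powR_sub|exact: sqr_continuous].
- apply: derivable_within_continuous => s /sT sltT; by have [] := dF s sltT.
- by apply: continuous_subspaceT => s; exact: cvg_id.
- move=> s; rewrite in_itv/= => /andP[_ st]; apply: dF; exact: lt_trans tT.
- by move=> s _; rewrite normr1.
- by move=> n i _; rewrite lexx ltW// tau_lt.
Qed.

Let ae_paths : {ae P, forall w, [/\ B 0 w = 0, X 0 w = 0,
   {within `[0, +oo[%classic, continuous (fun t : R => B t w)},
   {within `[0, T[%classic, continuous (fun t : R => X t w)} &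
   forall t : R, 0 <= t -> t < T ->
        X t w = \int[lebesgue_measure]_(s in `[0, t]) (- (alpha / (T - s)) * X s w)
                + B t w]}.
Proof.
have [B0 _ _ cB] := hB; have [_ X0 cX sde] := hX.
by near=> w; split; near: w.
Unshelve. all: by end_near. Qed.

Let Y_normal t : 0 < t -> t < T ->
  normally_distributed P 0 (V t) (Y t).
Proof.
move=> t0 tT; apply: (@normal_ae_limit _ _ _ P (fun n => wiener_sum n t) _
  (fun n => sum_var n t)).
- exact: V_gt0.
- move=> n; rewrite /sum_var big_ord_recl ltr_pwDl//; first exact: term_gt0.
  by apply: sumr_ge0 => i _; apply/ltW/term_gt0 => //; exact: ltn_ord.
- exact: sum_var_cvg.
- move=> n; apply: measurable_sum => i.
  by apply: measurable_funM => //; exact: measurable_increment.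
- exact: mY.
- by move=> n; exact: wiener_sum_normal.
- apply: filterS ae_paths => w [B0 X0 cB cX sde].
  exact: (@sde_path_riemann R T alpha (fun t => B t w) (fun t => X t w)).
Qed.

Let G := [set w | cvg (Y t w @[t --> T^'-])].

Let ae_G : {ae P, forall w, G w}.
Proof.
(* any exponent strictly between max alpha 0 and 1/2 would do *)
pose gam := (Num.max alpha 0 + 1 / 2) / 2.
have ma : alpha <= Num.max alpha 0 by rewrite le_max lexx.
have m0 : 0 <= Num.max alpha 0 by rewrite le_max lexx orbT.
have m1 : Num.max alpha 0 < 1 / 2 by rewrite gt_max alpha_lt; lra.
have g0 : 0 < gam by rewrite /gam; lra.
have g1 : gam < 1 / 2 by rewrite /gam; lra.
have ag : alpha < gam by rewrite /gam; lra.
have hol := wiener_holder_point hB T0 g0 g1.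
apply: filterS2 ae_paths hol => w [B0 X0 cB cX sde] [C [dl [dl0 H]]].
change (cvg ((T - t) `^ (- alpha) * X t w @[t --> T^'-])).
exact: (sde_path_cvg T0 cX sde dl0 ag g0 H).
Qed.

Let mG : measurable G.
Proof.
rewrite -(setCK G); apply/measurableC/hP.
by move: ae_G; rewrite /almost_everywhere.
Qed.

Let t_ (n : nat) := T - T / n.+2%:R.

Let t_in n : 0 < t_ n < T.
Proof.
rewrite subr_gt0 gtrBl divr_gt0// andbT ltr_pdivrMr// ltr_pMr//.
by rewrite ltr1n.
Qed.

Let t_cvg : t_ n @[n --> \oo] --> T^'-.
Proof.
move=> A [e /= e0 H].
exists (Num.bound (T / e)) => // n /= en; apply: H.
  rewrite /ball_/= /t_ subKr gtr0_norm ?divr_gt0// ltr_pdivrMr// mulrC -ltr_pdivrMr//.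
  apply: (lt_le_trans (archi_boundP _)); first by rewrite divr_ge0// ltW.
  by rewrite ler_nat (leq_trans en)// (leq_trans (leqnSn _)).
by have /andP[] := t_in n.
Qed.

(* the value 0 off G makes M a pointwise limit of measurable maps *)
Let M w := if w \in G then lim (Y t w @[t --> T^'-]) else 0.

Let M_cvg w : G w -> Y t w @[t --> T^'-] --> M w.
Proof. by move=> Gw; rewrite /M mem_set. Qed.

Let mM : measurable_fun setT M.
Proof.
apply: (@measurable_fun_cvg _ _ _ setT (fun n w => Y (t_ n) w * \1_G w)).
  by move=> n; apply: measurable_funM => //; exact: measurable_indic.
move=> w _; have [Gw|nGw] := pselect (G w).
  rewrite -[M w]mulr1 indicE mem_set//; apply: cvgM; last exact: cvg_cst.
  exact: (cvg_comp _ _ t_cvg (M_cvg Gw)).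
rewrite /M memNset// indicE memNset//.
by under eq_cvg do rewrite mulr0; exact: cvg_cst.
Qed.

Let VT := T `^ (1 - 2 * alpha) / (1 - 2 * alpha).

Let VT_gt0 : 0 < VT. Proof. by rewrite divr_gt0// powR_gt0. Qed.

Let M_normal : normally_distributed P 0 VT M.
Proof.
apply: (@normal_ae_limit _ _ _ P (fun n => Y (t_ n)) _ (fun n => V (t_ n))).
- exact: VT_gt0.
- by move=> n; have /andP[? ?] := t_in n; exact: V_gt0.
- rewrite /VT -[X in X / _]subr0; apply: cvgM; last exact: cvg_cst.
  apply: cvgB; first exact: cvg_cst.
  exact: (cvg_comp _ _ t_cvg (@powR_sub_cvg0 _ T _ a0)).
- by move=> n; exact: mY.
- exact: mM.
- by move=> n; have /andP[? ?] := t_in n; exact: Y_normal.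
- by apply: filterS ae_G => w Gw; exact: (cvg_comp _ _ t_cvg (M_cvg Gw)).
Qed.

(** The two successive limits: mesh to [0] for the law of [Y t], then [t] to [T]
    along a sequence for the law of [M]. *)
Lemma bridge_limit : exists M : {RV P >-> R},
  normally_distributed P 0 (T `^ (1 - 2 * alpha) / (1 - 2 * alpha)) M /\
  {ae P, forall w, (T - t) `^ (- alpha) * X t w @[t --> T^'-] --> M w}.
Proof.
pose M' : {RV P >-> R} := HB.pack M (isMeasurableFun.Build _ _ _ _ _ mM).
exists M'; split; first exact: M_normal.
by apply: filterS ae_G => w; exact: M_cvg.
Qed.

End bridge.

Lemma at_left_cvg_pm_infty (R : realType) (T : R) (f : R -> R) :
  f t @[t --> T^'-] --> +oo -> ~ (f t @[t --> T^'-] --> -oo).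
Proof.
move=> fy fNy.
have h1 : \forall t \near T^'-, 0 < f t.
  by move/cvgryPgt : fy => /(_ 0); apply.
have h2 : \forall t \near T^'-, f t < 0.
  by move/cvgrNyPlt : fNy => /(_ 0); apply.
have : \forall t \near T^'-, False.
  by apply: filterS2 h1 h2 => t a b; move: (lt_trans a b); rewrite ltxx.
by move=> /filter_ex[].
Qed.

Lemma cvgM_gt0_y (R : realType) (T : Type) (F : set_system T) (FF : Filter F)
    (f h : T -> R) (m : R) :
  0 < m -> f t @[t --> F] --> m -> h t @[t --> F] --> +oo ->
  f t * h t @[t --> F] --> +oo.
Proof.
move=> m0 fm hy; apply/cvgryPge => A.
have fm2 : \forall t \near F, m / 2 < f t.
  by apply: cvgr_gt fm _ _; rewrite gtr_pMr//; lra.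
have h0 : \forall t \near F, 0 <= h t by move/cvgryPge : hy; apply.
have hA : \forall t \near F, A / (m / 2) <= h t by move/cvgryPge : hy; apply.
near=> t.
apply: (@le_trans _ _ (m / 2 * h t)).
  by rewrite mulrC -ler_pdivrMr ?divr_gt0//; near: t.
by rewrite ler_wpM2r//; [near: t|apply: ltW; near: t].
Unshelve. all: by end_near. Qed.

Theorem theorem3p4 (R : realType) (d : measure_display)
    (Omega : measurableType d) (P : probability Omega R)
    (hP : measure_is_complete P)
    (T alpha : R) (hT : 0 < T) (halpha : alpha < 1 / 2)
    (B X : R -> {RV P >-> R})
    (hB : standard_wiener_process B) (hX : strong_solution alpha T B X) :
  [/\ exists M : {RV P >-> R},
        normally_distributed P 0 (T `^ (1 - 2 * alpha) / (1 - 2 * alpha)) M /\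
        has_prob P
          [set w | X t w / (T - t) `^ alpha @[t --> T^'-] --> M w] 1,
      forall beta : R, beta < alpha ->
        has_prob P
          [set w | X t w / (T - t) `^ beta @[t --> T^'-] --> (0 : R)] 1 &
      forall beta : R, alpha < beta ->
        has_prob P
          [set w | X t w / (T - t) `^ beta @[t --> T^'-] --> -oo] (1 / 2) /\
        has_prob P
          [set w | X t w / (T - t) `^ beta @[t --> T^'-] --> +oo] (1 / 2)].
Proof.
have [M [nM cM]] := bridge_limit hP hT halpha hB hX.
have ltT : \forall t \near T^'-, t < T by exact: nbhs_left_lt.
have PT : P setT = 1%:E by rewrite probability_setT.
have rescale beta w : {near T^'-, (fun t => (T - t) `^ (- alpha) * X t w *
    (T - t) `^ (alpha - beta)) =1 (fun t => X t w / (T - t) `^ beta)}.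
  near=> t.
  have Tt : 0 < T - t by rewrite subr_gt0; near: t.
  rewrite mulrAC -powRD_gt0// -powRN mulrC; congr (_ * _ `^ _); ring.
have cvg_rescale beta w (F : set_system R) :
    ((T - t) `^ (- alpha) * X t w * (T - t) `^ (alpha - beta) @[t --> T^'-] --> F) ->
    X t w / (T - t) `^ beta @[t --> T^'-] --> F.
  by apply: cvg_trans; apply: near_eq_cvg; exact: rescale.
have v0 : 0 < Num.sqrt (T `^ (1 - 2 * alpha) / (1 - 2 * alpha)).
  by rewrite sqrtr_gt0 divr_gt0 ?powR_gt0//; lra.
split.
- exists M; split=> //; apply: (@has_prob_of_ae _ _ _ P _ setT) => //.
  apply: filterS cM => w Mw; split=> // _ /=.
  have := @cvg_rescale alpha w (nbhs (M w)); apply.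
  rewrite subrr; under eq_cvg do rewrite powRr0 mulr1; exact: Mw.
- move=> beta ba; apply: (@has_prob_of_ae _ _ _ P _ setT) => //.
  apply: filterS cM => w Mw; split=> // _ /=.
  have := @cvg_rescale beta w (nbhs 0); apply.
  rewrite -(mulr0 (M w)); apply: cvgM => //.
  by apply: powR_sub_cvg0; rewrite subr_gt0.
move=> beta ab.
have b0 : alpha - beta < 0 by rewrite subr_lt0.
have cy := powR_sub_cvgy T b0.
have pos w : (T - t) `^ (- alpha) * X t w @[t --> T^'-] --> M w -> 0 < M w ->
    X t w / (T - t) `^ beta @[t --> T^'-] --> +oo.
  by move=> Mw M0; apply: cvg_rescale; exact: (cvgM_gt0_y _ M0 Mw cy).
have neg w : (T - t) `^ (- alpha) * X t w @[t --> T^'-] --> M w -> M w < 0 ->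
    X t w / (T - t) `^ beta @[t --> T^'-] --> -oo.
  move=> Mw M0; apply: cvg_rescale; apply/cvgNry.
  under eq_cvg do rewrite -mulNr.
  apply: (cvgM_gt0_y _ _ (cvgN Mw) cy); by rewrite oppr_gt0.
have mray (A : set R) : measurable A -> measurable (M @^-1` A).
  by move=> mA; rewrite -[X in measurable X]setTI; exact: measurable_funP.
have Ppos : P (M @^-1` `]0, +oo[%classic) = (1 / 2)%:E.
  by rewrite nM// normal_prob_gt0_half.
have Pneg : P (M @^-1` `]-oo, 0[%classic) = (1 / 2)%:E.
  by rewrite nM// normal_prob_lt0_half.
have M0 : {ae P, forall w, M w != 0}.
  exists (M @^-1` [set 0]); split; first exact: mray.
    rewrite nM//.
    have /null_content_dominatesP := normal_prob_dominates 0
      (Num.sqrt (T `^ (1 - 2 * alpha) / (1 - 2 * alpha))).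
    by apply => //; exact: lebesgue_measure_set1.
  by move=> w /= /negP; rewrite negbK => /eqP.
split.
- apply: (@has_prob_of_ae _ _ _ P _ (M @^-1` `]-oo, 0[%classic)) => //.
    exact: mray.
  apply: filterS2 cM M0 => w Mw Mw0 /=; rewrite in_itv/=; split.
    move=> Xw; rewrite ltNge; apply/negP; rewrite le_eqVlt eq_sym (negbTE Mw0)/=.
    by move=> /(pos _ Mw)/at_left_cvg_pm_infty.
  exact: neg.
- apply: (@has_prob_of_ae _ _ _ P _ (M @^-1` `]0, +oo[%classic)) => //.
    exact: mray.
  apply: filterS2 cM M0 => w Mw Mw0 /=; rewrite in_itv/= andbT; split.
    move=> Xw; rewrite ltNge; apply/negP; rewrite le_eqVlt (negbTE Mw0)/=.
    by move=> /(neg _ Mw); exact: at_left_cvg_pm_infty.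
  exact: pos.
Unshelve. all: by end_near. Qed.
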